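(* Let $n\ge1$, let $\Gamma\subset\mathbf{E}(n+1)$ be a crystallographic group with lattice $\mathcal{L}$ and point group $\mathbf{J}$, let $y_0>0$, and suppose $(0,y_0)\notin\mathcal{L}$. Let $\widetilde{\mathcal{L}}_{y_0}$ be the group of common periods of all functions in $\Pi_{y_0}(X_\Gamma)$. (1) If $((v_1,y_0),\sigma)\in\Gamma$ for some $v_1\in\mathbb{R}^n$, then $\widetilde{\mathcal{L}}_{y_0}$ is the lattice $\{\mathcal{R}_0(\mathcal{L}),v_1\}_{\mathbb{Z}}$ in $\mathbb{R}^n$. (2) If $((v_1,y_0),\sigma)\notin\Gamma$ for every $v_1\in\mathbb{R}^n$, then $\widetilde{\mathcal{L}}_{y_0}=\mathcal{R}_0(\mathcal{L})$. (3) If $\sigma$ is in the holohedry of $\mathcal{L}$ then $\widetilde{\mathcal{L}}_{y_0}$ is a lattice in $\mathbb{R}^n$; otherwise $\widetilde{\mathcal{L}}_{y_0}$ may have less than $n$ linearly independent generators (that is, there exist such $\Gamma$ and $y_0$, with $\sigma$ not in the holohedry of $\mathcal{L}$ and $(0,y_0)\notin\mathcal{L}$, for which $\widetilde{\mathcal{L}}_{y_0}$ contains fewer than $n$ linearly independent vectors).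
   Context: Points of $\mathbb{R}^{n+1}$ are written $(x,y)$ with $x\in\mathbb{R}^n$, $y\in\mathbb{R}$. A lattice in $\mathbb{R}^m$ is the set of all integer combinations of $m$ linearly independent vectors. The Euclidean group $\mathbf{E}(m)=\mathbb{R}^m\ltimes\mathbf{O}(m)$ consists of pairs $(v,\delta)$ acting by $(v,\delta)\cdot z=v+\delta z$. A crystallographic group $\Gamma\le\mathbf{E}(n+1)$ with lattice $\mathcal{L}$ is a subgroup such that $\mathcal{L}=\{v:(v,\mathrm{Id}_{n+1})\in\Gamma\}$ is a lattice in $\mathbb{R}^{n+1}$; its point group is $\mathbf{J}=\{\delta\in\mathbf{O}(n+1):(v,\delta)\in\Gamma\text{ for some }v\}$. The holohedry of $\mathcal{L}$ is the group of all $\delta\in\mathbf{O}(n+1)$ with $\delta\mathcal{L}=\mathcal{L}$. $\sigma\in\mathbf{O}(n+1)$ is $\sigma(x,y)=(x,-y)$. For $A\subset\mathbb{R}^{n+1}$ and $y\in\mathbb{R}$, $\mathcal{R}_y(A)=\{x\in\mathbb{R}^n:(x,y)\in A\}$. $\{\mathcal{R}_0(\mathcal{L}),v_1\}_{\mathbb{Z}}$ is the additive subgroup (the $\mathbb{Z}$-module) of $\mathbb{R}^n$ generated by $\mathcal{R}_0(\mathcal{L})\cup\{v_1\}$. $X_\Gamma$ is the vector space of all $C^1$ functions $f:\mathbb{R}^{n+1}\to\mathbb{R}$ with $f(\gamma^{-1}\cdot(x,y))=f(x,y)$ for all $\gamma\in\Gamma$ and all $(x,y)$. $\Pi_{y_0}(f)(x)=\int_0^{y_0}f(x,y)\,dy$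 for $x\in\mathbb{R}^n$, and $\Pi_{y_0}(X_\Gamma)=\{\Pi_{y_0}(f):f\in X_\Gamma\}$. $\widetilde{\mathcal{L}}_{y_0}=\{p\in\mathbb{R}^n:g(x+p)=g(x)\ \forall x\in\mathbb{R}^n,\ \forall g\in\Pi_{y_0}(X_\Gamma)\}$. *)

(* Defs.v *)
From HB Require Import structures.
From mathcomp Require Import all_boot all_order all_algebra.
From mathcomp Require Import all_classical all_reals all_analysis.
Set Implicit Arguments.
Unset Strict Implicit.
Unset Printing Implicit Defensive.
Import Order.TTheory GRing.Theory Num.Theory.
Import numFieldNormedType.Exports.
Local Open Scope classical_set_scope.
Local Open Scope ring_scope.

Section Lattices.
Variables (R : realType) (m : nat).

Definition is_lattice (L : set 'cV[R]_m) : Prop :=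
  exists b : m.-tuple 'cV[R]_m, free b /\
    L = [set v | exists k : 'I_m -> int, v = \sum_(i < m) b`_i *~ k i].

Definition additive_subgroup (H : set 'cV[R]_m) : Prop :=
  H 0 /\ forall u v, H u -> H v -> H (u - v).

Definition Zspan (A : set 'cV[R]_m) : set 'cV[R]_m :=
  smallest additive_subgroup A.

Definition orthogonal_mx (d : 'M[R]_m) : Prop := d^T *m d = 1%:M.

Definition holohedry (L : set 'cV[R]_m) : set 'M[R]_m :=
  [set d | orthogonal_mx d /\ mulmx d @` L = L].

End Lattices.

Section EuclideanGroup.
Variables (R : realType) (m : nat).

(* The semidirect product R^m x| O(m), carried by all pairs (v, d) of a vector
   and a square matrix; membership in E(m) is the predicate [euclidean]. *)
Definition euclidean : set ('cV[R]_m * 'M[R]_m) :=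
  [set g | orthogonal_mx g.2].

Definition eact (g : 'cV[R]_m * 'M[R]_m) (z : 'cV[R]_m) : 'cV[R]_m :=
  g.1 + g.2 *m z.

Definition eone : 'cV[R]_m * 'M[R]_m := (0, 1%:M).

Definition emul (g h : 'cV[R]_m * 'M[R]_m) : 'cV[R]_m * 'M[R]_m :=
  (g.1 + g.2 *m h.1, g.2 *m h.2).

Definition einv (g : 'cV[R]_m * 'M[R]_m) : 'cV[R]_m * 'M[R]_m :=
  (- (invmx g.2 *m g.1), invmx g.2).

Definition euclidean_subgroup (G : set ('cV[R]_m * 'M[R]_m)) : Prop :=
  [/\ G `<=` euclidean, G eone,
      forall g h, G g -> G h -> G (emul g h) &
      forall g, G g -> G (einv g)].

Definition translations (G : set ('cV[R]_m * 'M[R]_m)) : set 'cV[R]_m :=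
  [set v | G (v, 1%:M)].

Definition crystallographic (G : set ('cV[R]_m * 'M[R]_m)) : Prop :=
  euclidean_subgroup G /\ is_lattice (translations G).

Lemma emul_act (g h : 'cV[R]_m * 'M[R]_m) (z : 'cV[R]_m) :
  eact (emul g h) z = eact g (eact h z).
Proof. by rewrite /eact /emul /= mulmxDr !mulmxA addrA. Qed.

Lemma einv_mul (g : 'cV[R]_m * 'M[R]_m) :
  euclidean g -> emul (einv g) g = eone.
Proof.
by move=> /mulmx1_unit[_ gU]; rewrite /emul /einv /= addNr mulVmx.
Qed.

End EuclideanGroup.

Section Projection.
Variables (R : realType) (n : nat).

Definition pt (x : 'cV[R]_n) (y : R) : 'cV[R]_(n + 1) := col_mx x y%:M.

Definition sigma : 'M[R]_(n + 1) := block_mx 1%:M 0 0 (-1)%:M.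

Lemma sigma_pt (x : 'cV[R]_n) (y : R) : sigma *m pt x y = pt x (- y).
Proof.
rewrite /sigma /pt mul_block_col mul1mx !mul0mx addr0 add0r.
by rewrite -scalar_mxM mulN1r.
Qed.

Definition slice (y : R) (A : set 'cV[R]_(n + 1)) : set 'cV[R]_n :=
  [set x | A (pt x y)].

(* In finite dimension, pointwise continuity of the differential is the same as
   its continuity in operator norm. *)
Definition is_C1 (f : 'cV[R]_(n + 1) -> R) : Prop :=
  (forall z, differentiable f z) /\
  forall h, continuous (fun z => 'd f z h).

Definition invariant_functions (G : set ('cV[R]_(n + 1) * 'M[R]_(n + 1))) :
    set ('cV[R]_(n + 1) -> R) :=
  [set f | is_C1 f /\ forall g, G g -> forall z, f (eact (einv g) z) = f z].

Definition projection (y0 : R) (f : 'cV[R]_(n + 1) -> R) (x : 'cV[R]_n) : R :=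
  Rintegral lebesgue_measure `[0, y0] (fun y => f (pt x y)).

Definition periods (y0 : R) (G : set ('cV[R]_(n + 1) * 'M[R]_(n + 1))) :
    set 'cV[R]_n :=
  [set p | forall g, (projection y0 @` invariant_functions G) g ->
             forall x, g (x + p) = g x].

End Projection.

Arguments sigma {R n}.

(* Main.v *)
Require Import Defs.
From HB Require Import structures.
From mathcomp Require Import all_boot all_order all_algebra.
From mathcomp Require Import all_classical all_reals all_analysis.
From mathcomp Require Import ring lra.
Set Implicit Arguments.
Unset Strict Implicit.
Unset Printing Implicit Defensive.
Import Order.TTheory GRing.Theory Num.Theory.
Import numFieldNormedType.Exports.
Local Open Scope classical_set_scope.
Local Open Scope ring_scope.

(** Write L for the translation lattice, and call a vector v a reflection of the
    group when (v, sigma) belongs to it.  A horizontal vector of L is a period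
    because invariant functions are L-periodic; if (p, y0) is a reflection then
    f (x + p, y) = f (x, y0 - y), and the change of variable y |-> y0 - y shows
    that p is a period.  The content of the theorem is the converse.

    Invariant functions are produced from a C1 function k that is L-periodic by
    summing k o gamma over one gamma per element of the (finite) point group
    ([orbit_sum_invariant], [finite_point_group]).  The sum is finite, so it is
    C1 without any convergence argument.  For k one takes bumps concentrated
    near z0 + L, built from the L-periodic function [lattice_gap], which vanishes
    exactly on L: positive parts of e - lattice_gap are supported as close to
    the lattice as desired.

    Let z0 = (x, q).  If the linear part d of gamma is neither 1 nor sigma, then
    the condition that gamma maps the vertical line over x, or over x + p, to a
    line meeting z0 + L is a proper affine condition on x.  There are countably
    many of them, so that some x avoids them all ([generic_line]), and for a
    small enough bump only the terms d = 1 and d = sigma contribute to the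
    integrals over x and over x + p.  Taking for k the vertical derivative of a
    bump, these two terms are computed by the fundamental theorem of calculus
    and only see which endpoints of the segment lie in z0 + L.  A period p thus
    satisfies, for every q, the identity [endpoint_count_period] between signed
    counts of lattice vectors at heights y0 - q and -q and of reflections at
    heights q and y0 + q, above p and above 0.

    At q = 0 and q = y0 these identities give that (p, 0) is in L or (p, y0) is
    a reflection, except when (0, 0) is a reflection and (0, 2 y0) is in L,
    where all the terms may cancel.  There, a nonnegative bump shows at least
    that (p, w) is in L for some height w ([vertical_translate]); applying sigma,
    (0, 2 w) is in L, and since the heights of the vertical vectors of L form a
    cyclic group in which 2 y0 and 2 w are odd multiples of the generator,
    (0, y0 - w) is in L ([vertical_half]).  Hence (p, y0) is in L, so that it is
    a reflection.

    That the group of periods is a lattice when sigma preserves L is algebra: it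
    lies between the horizontal vectors of L, which form a lattice because
    they contain v + sigma v for all v in L, and the halves of these vectors.
    The last assertion is witnessed by the translation group of a lattice sheared
    vertically by sqrt 2 along one horizontal axis: horizontal vectors of this
    lattice have a zero coordinate along that axis. *)

(** * Functions of one variable *)

Section OneVariable.
Variable R : realType.
Implicit Types (t u x : R) (k : int).

(** The exponent 2 is the least one for which this truncation is C1, with a
    derivative that needs no case distinction. *)
Definition pos_sq u : R := Num.max 0 u ^+ 2.

Lemma is_derive_pos_sq x : is_derive x 1 pos_sq (2 * Num.max 0 x).
Proof.
(* The difference quotient is within |z - x| of the derivative, on either side
   of the corner of the maximum. *)
apply/is_derive1_caratheodory.
pose q z := if z == x then 2 * Num.max 0 x else (pos_sq z - pos_sq x) / (z - x).
exists q; split.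
- move=> z; rewrite /q; case: eqVneq => [->|zx]; first by rewrite !subrr mulr0.
  by rewrite mulfVK// subr_eq0.
- have qx : q x = 2 * Num.max 0 x by rewrite /q eqxx.
  apply/cvgrPdist_le => /= e e0; rewrite qx.
  near=> z; apply: (@le_trans _ _ `|x - z|); last first.
    near: z.
    have /cvgrPdist_le/(_ e e0) : z @[z --> x] --> x by exact: cvg_id.
    by [].
  rewrite /q; case: eqVneq => [->|zx]; first by rewrite !subrr.
  have zx0 : `|z - x| > 0 by rewrite normr_gt0 subr_eq0.
  have -> : 2 * Num.max 0 x - (pos_sq z - pos_sq x) / (z - x) =
      (2 * Num.max 0 x * (z - x) - (pos_sq z - pos_sq x)) / (z - x).
    by field; rewrite subr_eq0.
  rewrite normrM normfV ler_pdivrMr// (distrC x) -expr2 real_normK ?num_real//.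
  rewrite ler_norml /pos_sq.
  by case: (leP 0 z) => ?; case: (leP 0 x) => ?; nra.
- by rewrite /q eqxx.
Unshelve. all: by end_near. Qed.

Lemma is_derive_pos_cube x :
  is_derive x 1 (fun u => u * pos_sq u) (3 * pos_sq x).
Proof.
have ? := is_derive_pos_sq x.
apply: is_derive_eq.
rewrite /GRing.scale /= /pos_sq; case: (leP 0 x) => _; ring.
Qed.

Lemma periodic_int (f : R -> R) t k : periodic f (pi *+ 2) ->
  f (2 * pi * (t + k%:~R)) = f (2 * pi * t).
Proof.
move=> fper; have fn n u : f (2 * pi * (u + n%:R)) = f (2 * pi * u).
  by rewrite -(periodicn fper n (_ * u)) mulrDr -[pi *+ 2]mulr_natl mulr_natr.
case: k => n; first exact: fn.
by rewrite NegzE mulrNz -[LHS](fn n.+1) -[_%:~R]/(n.+1%:R) subrK.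
Qed.

Lemma cos_2pi_int t : cos (2 * pi * t) = 1 -> t \is a Num.int.
Proof.
pose s := t - (Num.floor t)%:~R.
have -> : t = s + (Num.floor t)%:~R by rewrite subrK.
rewrite (periodic_int _ _ (@cosD2pi R)).
have s0 : 0 <= s by rewrite subr_ge0 floor_le.
have s1 : s < 1.
  by have := floorD1_gt t; rewrite /s intrD; lra.
rewrite -mulrA [2 * _]mulr_natl.
rewrite cos_mulr2n -[_ *+ 2]mulr_natl => c1.
have : sin (pi * s) ^+ 2 == 0.
  by rewrite sin2cos2; apply/eqP; lra.
rewrite sqrf_eq0 => /eqP sin0.
move: s0; rewrite le_eqVlt => /predU1P[<-|s0]; first by rewrite add0r intr_int.
suff : 0 < sin (pi * s) by rewrite sin0 ltxx.
apply: sin_gt0_pi; have := pi_gt0 R; nra.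
Qed.

End OneVariable.

(** * Closure properties of C1 functions *)

Section ContinuousOps.
Variables (R : realType) (T : topologicalType) (f g : T -> R).
Hypotheses (cf : continuous f) (cg : continuous g).

Lemma continuous_add : continuous (fun z => f z + g z).
Proof. by move=> z; apply: cvgD; [exact: cf|exact: cg]. Qed.

Lemma continuous_mul : continuous (fun z => f z * g z).
Proof. by move=> z; apply: cvgM; [exact: cf|exact: cg]. Qed.

End ContinuousOps.

Section C1.
Variables (R : realType) (n : nat).
Implicit Types f g : 'cV[R]_(n + 1) -> R.

Lemma C1_cst (c : R) : is_C1 (fun _ : 'cV[R]_(n + 1) => c).
Proof.
split=> [z|h]; first exact: differentiable_cst.
under eq_fun do rewrite diff_cst.
exact: cst_continuous.
Qed.

Lemma C1D f g : is_C1 f -> is_C1 g -> is_C1 (fun z => f z + g z).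
Proof.
move=> [df cf] [dg cg]; split=> [z|h]; first exact: differentiableD.
have -> : (fun z => 'd (fun z => f z + g z) z h) =
    (fun z => 'd f z h + 'd g z h).
  by apply/funext => z; rewrite (diffD (df z) (dg z)).
exact: continuous_add (cf h) (cg h).
Qed.

Lemma C1_continuous f : is_C1 f -> continuous f.
Proof. by move=> [df _] z; exact: differentiable_continuous. Qed.

Lemma C1M f g : is_C1 f -> is_C1 g -> is_C1 (fun z => f z * g z).
Proof.
move=> C1f C1g; have [[df cf] [dg cg]] := (C1f, C1g).
split=> [z|h]; first exact: differentiableM.
have -> : (fun z => 'd (fun z => f z * g z) z h) =
    (fun z => f z * 'd g z h + g z * 'd f z h).
  by apply/funext => z; rewrite (diffM (df z) (dg z)).
exact: continuous_add (continuous_mul (C1_continuous C1f) (cg h))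
  (continuous_mul (C1_continuous C1g) (cf h)).
Qed.

Lemma C1_comp (phi dphi : R -> R) f :
  (forall x : R, is_derive x 1 phi (dphi x)) -> continuous dphi ->
  is_C1 f -> is_C1 (fun z => phi (f z)).
Proof.
move=> dphiE cdphi C1f; have [df cf] := C1f.
have dp x : differentiable phi x.
  by apply/derivable1_diffP; have [] := dphiE x.
split=> [z|h]; first exact: differentiable_comp.
have -> : (fun z => 'd (fun z => phi (f z)) z h) =
    (fun z => 'd f z h * dphi (f z)).
  apply/funext => z; rewrite (diff_comp (df z) (dp (f z))) /= diff1E//.
  by rewrite derive1E; have [_ ->] := dphiE (f z).
apply: continuous_mul (cf h) _ => z.
by apply: continuous_comp; [exact: (C1_continuous C1f)|exact: cdphi].
Qed.

Lemma C1_sum (I : Type) (s : seq I) (F : I -> 'cV[R]_(n + 1) -> R) :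
  (forall i, is_C1 (F i)) -> is_C1 (fun z => \sum_(i <- s) F i z).
Proof.
move=> C1F; elim: s => [|i s IHs].
  by under eq_fun do rewrite big_nil; exact: C1_cst.
by under eq_fun do rewrite big_cons; exact: C1D.
Qed.

(** Coordinates generate all the C1 functions used below: linear forms are
    combinations of coordinates, and bumps are functions of linear forms. *)
Lemma C1_coord (j : 'I_(n + 1)) : is_C1 (fun z : 'cV[R]_(n + 1) => z j 0).
Proof.
have lin : linear (fun z : 'cV[R]_(n + 1) => z j 0 : R).
  by move=> a u v; rewrite !mxE.
pose lf : {linear 'cV[R]_(n + 1) -> R} :=
  HB.pack (fun z : 'cV[R]_(n + 1) => z j 0 : R)
    (GRing.isLinear.Build _ _ _ _ _ lin).
have clf : continuous lf by exact: coord_continuous.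
split=> [z|h]; first exact: differentiable_coord.
have -> : (fun z => 'd (fun z : 'cV[R]_(n + 1) => z j 0) z h) = cst (h j 0).
  by apply/funext => z; exact: (congr1 (@^~ h) (diff_lin z clf)).
exact: cst_continuous.
Qed.

Lemma C1_scalar (xi : {scalar 'cV[R]_(n + 1)}) : is_C1 xi.
Proof.
have -> : (xi : 'cV[R]_(n + 1) -> R) =
    (fun z => \sum_(j <- index_enum 'I_(n + 1)) xi (delta_mx j 0) * z j 0).
  apply/funext => z; rewrite {1}[z]matrix_sum_delta linear_sum/=.
  apply: eq_bigr => j _; rewrite big_ord1 linearZ /=; exact: mulrC.
apply: C1_sum => j; apply: C1M; [exact: C1_cst|exact: C1_coord].
Qed.

End C1.

(** * Bumps periodic along a lattice *)

Section LatticeCoordinates.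
Variables (R : realType) (m : nat).
Implicit Types (b : m.-tuple 'cV[R]_m) (z v : 'cV[R]_m).

Definition lattice_of b : set 'cV[R]_m :=
  [set v | exists k : 'I_m -> int, v = \sum_(i < m) b`_i *~ k i].

Lemma coord_expansion b z : free b -> z = \sum_(i < m) coord b i z *: b`_i.
Proof.
move=> fb; apply: coord_basis (memvf z).
by rewrite basisEfree fb subvf /= dimvf size_tuple dim_matrix mulr1.
Qed.

Lemma lattice_ofP b v : free b ->
  lattice_of b v <-> forall i, coord b i v \is a Num.int.
Proof.
move=> fb; split=> [[k ->] i|int_v].
  under eq_bigr do rewrite -scaler_int.
  by rewrite coord_sum_free// intr_int.
exists (fun i => Num.floor (coord b i v)).
rewrite {1}(coord_expansion v fb); apply: eq_bigr => i _.
by rewrite -scaler_int floorK.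
Qed.

(** A smooth periodic substitute for the distance to the lattice. *)
Definition lattice_gap b z : R := \sum_(i < m) (1 - cos (2 * pi * coord b i z)).

Lemma lattice_gap_ge0 b z : 0 <= lattice_gap b z.
Proof. by apply: sumr_ge0 => i _; rewrite subr_ge0 cos_le1. Qed.

Lemma lattice_gap_eq0 b z : free b -> lattice_gap b z = 0 <-> lattice_of b z.
Proof.
move=> fb; split=> [/eqP|/(lattice_ofP _ fb) int_z].
  rewrite psumr_eq0 => [/allP gap0|i _]; last by rewrite subr_ge0 cos_le1.
  apply/(lattice_ofP _ fb) => i; apply: cos_2pi_int.
  by have := gap0 i (mem_index_enum i); rewrite subr_eq0 => /eqP.
rewrite /lattice_gap big1// => i _; have /intrP[k ->] := int_z i.
by rewrite -[k%:~R]add0r (periodic_int _ _ (@cosD2pi R)) mulr0 cos0 subrr.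
Qed.

(** This is max(0, e - lattice_gap)^3: the cube leaves a derivative that is
    still C1. *)
Definition periodic_bump b (e : R) z : R :=
  (e - lattice_gap b z) * pos_sq (e - lattice_gap b z).

(** The derivative of [lattice_gap b] at z in the direction w. *)
Definition slope b (w z : 'cV[R]_m) : R :=
  \sum_(i < m) (2 * pi * coord b i w) * sin (2 * pi * coord b i z).

(** The derivative of [periodic_bump b e] at z in the direction w; being C1, it
    is the test function to which the fundamental theorem of calculus applies. *)
Definition bump_slope b (e : R) w z : R :=
  - (3 * pos_sq (e - lattice_gap b z) * slope b w z).

Lemma coord_int_shift b i z l : free b -> lattice_of b l ->
  exists k : int, coord b i (z + l) = coord b i z + k%:~R.
Proof.
move=> fb /(lattice_ofP _ fb)/(_ i)/intrP[k lk].
by exists k; rewrite -lk raddfD.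
Qed.

Lemma lattice_gapD b z l : free b -> lattice_of b l ->
  lattice_gap b (z + l) = lattice_gap b z.
Proof.
move=> fb bl; apply: eq_bigr => i _; have [k ->] := coord_int_shift i z fb bl.
by rewrite (periodic_int _ _ (@cosD2pi R)).
Qed.

Lemma slopeD b w z l : free b -> lattice_of b l ->
  slope b w (z + l) = slope b w z.
Proof.
move=> fb bl; apply: eq_bigr => i _; have [k ->] := coord_int_shift i z fb bl.
by rewrite (periodic_int _ _ (@sinD2pi R)).
Qed.

Lemma pos_sq_le0 (x : R) : x <= 0 -> pos_sq x = 0.
Proof. by move=> x0; rewrite /pos_sq max_l// expr0n. Qed.

Lemma is_derive_gap b z w (y : R) :
  is_derive y 1 (fun y => lattice_gap b (z + y *: w)) (slope b w (z + y *: w)).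
Proof.
rewrite (_ : (fun y => _) = \sum_(i < m)
    (fun y => 1 - cos (2 * pi * coord b i (z + y *: w)))); last first.
  by apply/funext => t; rewrite fct_sumE.
apply: is_derive_sum => i.
rewrite (_ : (fun y => _) = (fun y => 1 - cos
    (2 * pi * coord b i z + (2 * pi * coord b i w) * y))); last first.
  by apply/funext => t; rewrite linearD linearZ/=; congr (1 - cos _); ring.
rewrite (_ : 2 * pi * coord b i (z + y *: w) =
    2 * pi * coord b i z + (2 * pi * coord b i w) * y); last first.
  by rewrite linearD linearZ/=; ring.
apply: is_derive_eq; rewrite /GRing.scale/=.
by ring.
Qed.

Lemma is_derive_bump b e z w (y : R) :
  is_derive y 1 (fun y => periodic_bump b e (z + y *: w))
     (bump_slope b e w (z + y *: w)).
Proof.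
rewrite /periodic_bump.
have dgap := is_derive_gap b z w y.
have dpos := is_derive_pos_cube (e - lattice_gap b (z + y *: w)).
have dsub : is_derive y 1 (fun y => e - lattice_gap b (z + y *: w))
    (- slope b w (z + y *: w)).
  by apply: is_derive_eq; rewrite add0r mul1r.
have := @is_derive1_comp _ (fun u => u * pos_sq u)
  (fun y => e - lattice_gap b (z + y *: w)) y _ _ dpos dsub.
by rewrite mulrN.
Qed.

End LatticeCoordinates.

(** * Integrals along vertical segments *)

Section Integrals.
Variable R : realType.
Local Notation mu := (@lebesgue_measure R).

Lemma continuous_integrable_itv (f : R -> R) (a b : R) : continuous f ->
  mu.-integrable `[a, b] (EFin \o f).
Proof.
move=> cf; apply: continuous_compact_integrable; first exact: segment_compact.
exact: continuous_subspaceT.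
Qed.

Lemma Rintegral_derivative (F f : R -> R) (a b : R) : a < b ->
  (forall x : R, is_derive x 1 F (f x)) -> continuous f ->
  Rintegral mu `[a, b] f = F b - F a.
Proof.
move=> ab dF cf; rewrite /Rintegral (@continuous_FTC2 _ f F a b)//.
- exact: continuous_subspaceT.
- have cF x : {for x, continuous F}.
    by apply/differentiable_continuous/derivable1_diffP; have [] := dF x.
  split=> [x _||]; first by have [] := dF x.
  + by apply: cvg_at_right_filter; exact: cF.
  + by apply: cvg_at_left_filter; exact: cF.
- by move=> x _; rewrite derive1E; have [_ ->] := dF x.
Qed.

Lemma Rintegral_sum_continuous (I : Type) (s : seq I) (F : I -> R -> R)
    (a b : R) : (forall i, continuous (F i)) ->
  Rintegral mu `[a, b] (fun y => \sum_(i <- s) F i y) =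
  \sum_(i <- s) Rintegral mu `[a, b] (F i).
Proof.
move=> cF; have csum r : continuous (fun y => \sum_(i <- r) F i y).
  elim: r => [|i r IHr].
    by under eq_fun do rewrite big_nil; exact: cst_continuous.
  by under eq_fun do rewrite big_cons; exact: continuous_add.
elim: s => [|i s IHs].
  rewrite big_nil (_ : (fun y => _) = cst 0) ?Rintegral_cst// ?mul0r//.
  by apply/funext => y; rewrite big_nil.
rewrite (_ : (fun y => _) = (fun y => F i y + \sum_(j <- s) F j y)); last first.
  by apply/funext => y; rewrite big_cons.
by rewrite big_cons RintegralD// ?IHs//; exact: continuous_integrable_itv.
Qed.

Lemma Rintegral_reflect (u : R -> R) (b : R) : 0 < b -> continuous u ->
  Rintegral mu `[0, b] (fun y => u (b - y)) = Rintegral mu `[0, b] u.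
Proof.
move=> b0 cu; pose F (y : R) := b - y.
have dF (y : R) : is_derive y 1 F (-1).
  by apply: is_derive_eq; rewrite add0r mul1r.
have F'E : derive1 F = cst (-1).
  by apply/funext => y; rewrite derive1E; have [_ ->] := dF y.
have cF : continuous F.
  by move=> x; apply/differentiable_continuous/derivable1_diffP; have [] := dF x.
have [F0 Fb] : F 0 = b /\ F b = 0 by rewrite /F subr0 subrr.
have := @integration_by_substitution_decreasing R F u 0 b (ltW b0).
rewrite F0 Fb /Rintegral => ->.
- by rewrite F'E; congr fine; apply: eq_integral => y _; rewrite /= opprK mulr1.
- by move=> x y _ _ xy; rewrite /F; lra.
- by rewrite F'E => ? _; exact: cst_continuous.
- by rewrite F'E; exact: is_cvg_cst.
- by rewrite F'E; exact: is_cvg_cst.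
- split=> [x _||]; first by have [] := dF x.
  + by apply: cvg_at_right_filter; exact: cF.
  + by apply: cvg_at_left_filter; exact: cF.
- exact: continuous_subspaceT.
Qed.

(** A multiple of pos_sq (d - y), whose primitive is explicit, lies below u as
    soon as d is so small that u exceeds half of its value at 0 on [0, d]. *)
Lemma Rintegral_gt0 (u : R -> R) (b : R) : 0 < b -> continuous u ->
  (forall y, 0 <= u y) -> 0 < u 0 -> 0 < Rintegral mu `[0, b] u.
Proof.
move=> b0 cu u_ge0 u0.
have [d [d0 db du]] : exists d, [/\ 0 < d, d <= b &
    forall y, 0 <= y -> y < d -> u 0 / 2 <= u y].
  have /cvgrPdist_lt/(_ (u 0 / 2)) := cu 0.
  rewrite divr_gt0// => /(_ isT)[r /= r0 ur].
  exists (Num.min r b); split; rewrite ?lt_min ?r0 ?b0 ?ge_min ?lexx ?orbT//.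
  move=> y y0; rewrite lt_min => /andP[yr _].
  have := ur y; rewrite /= sub0r normrN ger0_norm// => /(_ yr).
  by rewrite ltr_norml; lra.
pose k := u 0 / 2 / d ^+ 2.
have k0 : 0 < k by rewrite !divr_gt0// exprn_gt0.
pose v y := k * pos_sq (d - y).
pose V y := - (k / 3) * ((d - y) * pos_sq (d - y)).
have dV (y : R) : is_derive y 1 V (v y).
  have dpos := is_derive_pos_cube (d - y).
  have dsub : is_derive y 1 (fun y => d - y) (- 1).
    by apply: is_derive_eq; rewrite add0r mul1r.
  have dcomp : is_derive y 1 (fun y => (d - y) * pos_sq (d - y))
      (3 * pos_sq (d - y) * -1).
    exact: (@is_derive1_comp _ (fun u => u * pos_sq u) _ y _ _ dpos dsub).
  by apply: is_derive_eq; rewrite /GRing.scale /= /v; field.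
have cv : continuous v.
  have cpos : continuous (@pos_sq R).
    move=> x; apply/differentiable_continuous/derivable1_diffP.
    by have [] := is_derive_pos_sq x.
  apply: continuous_mul; first exact: cst_continuous.
  move=> x; apply: (@continuous_comp _ _ _ (fun y => d - y) (@pos_sq R)).
    by apply: cvgB; [exact: cvg_cst|exact: cvg_id].
  exact: cpos.
apply: (@lt_le_trans _ _ (Rintegral mu `[0, b] v)).
  rewrite (Rintegral_derivative b0 dV cv) /V subr0 (@pos_sq_le0 _ (d - b)); last lra.
  rewrite /pos_sq max_r ?(ltW d0)// !mulr0 sub0r mulNr opprK.
  by rewrite mulr_gt0 ?divr_gt0// mulr_gt0// exprn_gt0.
apply: le_Rintegral => //; [exact: continuous_integrable_itv..|].
move=> y /=; rewrite in_itv/= => /andP[y0 yb]; rewrite /v.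
case: (ltP y d) => [yd|dy]; last by rewrite pos_sq_le0 ?mulr0// subr_le0.
apply: le_trans (du y y0 yd); rewrite /k /pos_sq max_r ?subr_ge0 ?(ltW yd)//.
rewrite -mulrA ger_pMr ?divr_gt0// ler_pdivrMl ?exprn_gt0// mulr1.
by rewrite lerXn2r ?nnegrE; lra.
Qed.

End Integrals.

Section Vertical.
Variables (R : realType) (n : nat).

Lemma pt_line (x : 'cV[R]_n) (y : R) : pt x y = pt x 0 + y *: pt 0 1.
Proof.
rewrite /pt scale_col_mx add_col_mx scaler0 addr0; congr col_mx.
by rewrite scale_scalar_mx mulr1 raddf0 add0r.
Qed.

Lemma continuous_vertical (f : 'cV[R]_(n + 1) -> R) (x : 'cV[R]_n) :
  continuous f -> continuous (fun y : R => f (pt x y)).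
Proof.
move=> cf y; apply: continuous_comp; last exact: cf.
rewrite (_ : pt x = fun y => pt x 0 + y *: pt 0 1); last first.
  by apply/funext => t; rewrite pt_line.
apply: continuousD; first exact: cst_continuous.
exact: scalel_continuous.
Qed.

Variable b : (n + 1).-tuple 'cV[R]_(n + 1).
Variables (c : 'cV[R]_(n + 1)) (d : 'M[R]_(n + 1)).

Lemma C1_coord_affine i : is_C1 (fun z => coord b i (c + d *m z)).
Proof.
under eq_fun do rewrite raddfD/=.
apply: C1D; first exact: C1_cst.
exact: (C1_scalar (coord b i \o mulmx d)).
Qed.

Lemma C1_pos_gap e : is_C1 (fun z => pos_sq (e - lattice_gap b (c + d *m z))).
Proof.
apply: (C1_comp (@is_derive_pos_sq R)).
  rewrite (_ : (fun x => _) = (fun x => x + `|x|)).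
    apply: continuous_add; [by move=> x; exact: cvg_id|exact: norm_continuous].
  by apply/funext => x; case: (leP 0 x) => x0;
    [rewrite ger0_norm|rewrite ltr0_norm]; rewrite //; ring.
have dcos (x : R) : is_derive x 1 (fun t => 1 - cos (2 * pi * t))
    (2 * pi * sin (2 * pi * x)).
  by apply: is_derive_eq; rewrite /GRing.scale/=; ring.
have csin : continuous (fun x : R => 2 * pi * sin (2 * pi * x)).
  apply: continuous_mul; first exact: cst_continuous.
  move=> x; apply: (@continuous_comp _ _ _ ( *%R (2 * pi)) sin);
    last exact: continuous_sin.
  by apply: continuous_mul; [exact: cst_continuous|move=> ?; exact: cvg_id].
rewrite (_ : (fun z => _) = (fun z => e + (-1) *
    \sum_(i <- index_enum 'I_(n + 1))
      (1 - cos (2 * pi * coord b i (c + d *m z))))); last first.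
  by apply/funext => z; rewrite mulN1r.
apply: C1D; first exact: C1_cst.
apply: C1M; first exact: C1_cst.
apply: C1_sum => i; apply: (C1_comp dcos csin); exact: C1_coord_affine.
Qed.

Lemma C1_bump_slope e w : is_C1 (fun z => bump_slope b e w (c + d *m z)).
Proof.
have dsin (x : R) : is_derive x 1 (fun t => sin (2 * pi * t))
    (2 * pi * cos (2 * pi * x)).
  by apply: is_derive_eq; rewrite /GRing.scale/=; ring.
have ccos : continuous (fun x : R => 2 * pi * cos (2 * pi * x)).
  apply: continuous_mul; first exact: cst_continuous.
  move=> x; apply: (@continuous_comp _ _ _ ( *%R (2 * pi)) cos);
    last exact: continuous_cos.
  by apply: continuous_mul; [exact: cst_continuous|move=> ?; exact: cvg_id].
rewrite (_ : (fun z => _) = (fun z => (-3) * (pos_sq (e - lattice_gap b (c + d *m z)) *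
    \sum_(i <- index_enum 'I_(n + 1)) (2 * pi * coord b i w) *
       sin (2 * pi * coord b i (c + d *m z))))); last first.
  by apply/funext => z; rewrite /bump_slope /slope; ring.
apply: C1M; first exact: C1_cst.
apply: C1M; first exact: C1_pos_gap.
apply: C1_sum => i; apply: C1M; first exact: C1_cst.
apply: (C1_comp dsin ccos); exact: C1_coord_affine.
Qed.

End Vertical.

(** * Euclidean groups and finiteness of the point group *)

Section CrystallographicGroups.
Variables (R : realType) (m : nat).
Implicit Types (G : set ('cV[R]_m * 'M[R]_m)) (u v l : 'cV[R]_m) (d : 'M[R]_m).

Definition point_group G : set 'M[R]_m := [set d | exists v, G (v, d)].

Lemma orthogonal_unit d : orthogonal_mx d -> d \in unitmx.
Proof. by move=> /mulmx1_unit[]. Qed.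

Section Group.
Variable G : set ('cV[R]_m * 'M[R]_m).
Hypothesis groupG : euclidean_subgroup G.
Let L := translations G.

Lemma group_orthogonal v d : G (v, d) -> orthogonal_mx d.
Proof. by case: groupG => + _ _ _ => /[apply]. Qed.

Lemma group_comp v d v' d' : G (v, d) -> G (v', d') -> G (v + d *m v', d *m d').
Proof. by case: groupG => _ _ GM _ g h; exact: (GM _ _ g h). Qed.

Lemma group_inv v d : G (v, d) -> G (- (invmx d *m v), invmx d).
Proof. by case: groupG => _ _ _ GV g; exact: (GV _ g). Qed.

Lemma group_divr v d v' : G (v, d) -> G (v', d) -> L (v - v').
Proof.
move=> g g'; have ud := orthogonal_unit (group_orthogonal g).
have := group_comp g (group_inv g').
by rewrite mulmxN mulmxA mulmxV// mul1mx.
Qed.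

Lemma translationsD u v : L u -> L v -> L (u + v).
Proof. by move=> Lu Lv; have := group_comp Lu Lv; rewrite !mul1mx. Qed.

Lemma translationsN u : L u -> L (- u).
Proof. by move=> Lu; have := group_inv Lu; rewrite invmx1 mul1mx. Qed.

Lemma translations0 : L 0.
Proof. by case: groupG. Qed.

Lemma translationsB u v : L u -> L v -> L (u - v).
Proof. by move=> Lu /translationsN; exact: translationsD. Qed.

Lemma group_translate l v d : L l -> G (v, d) -> G (v + l, d).
Proof. by move=> Ll g; have := group_comp Ll g; rewrite !mul1mx addrC. Qed.

Lemma point_group_translations d l : point_group G d -> L l -> L (d *m l).
Proof.
move=> [v g] Ll; have := group_comp g Ll; rewrite mulmx1 => g'.
by have := group_divr g' g; rewrite addrC addKr.
Qed.

Lemma point_groupM d d' : point_group G d -> point_group G d' ->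
  point_group G (d *m d').
Proof. by move=> [v g] [v' g']; exists (v + d *m v'); exact: group_comp. Qed.

Lemma point_groupV d : point_group G d -> point_group G (invmx d).
Proof. by move=> [v g]; exists (- (invmx d *m v)); exact: group_inv. Qed.

Lemma point_group_holohedry : point_group G `<=` holohedry L.
Proof.
move=> d Jd; have [v g] := Jd; split; first exact: group_orthogonal g.
apply/seteqP; split=> [_ [l Ll <-]|l Ll]; first exact: point_group_translations.
exists (invmx d *m l).
  by apply: point_group_translations => //; exact: point_groupV.
by rewrite mulmxA mulmxV ?mul1mx//; exact: orthogonal_unit (group_orthogonal g).
Qed.

End Group.

Lemma orthogonal_entry_le1 d i j : orthogonal_mx d -> `|d i j| <= 1.
Proof.
move=> /matrixP/(_ j j); rewrite !mxE eqxx mulr1n.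
under eq_bigr do rewrite mxE -expr2.
move=> col_j; rewrite -(@ler_pXn2r _ 2)// ?nnegrE// expr1n real_normK ?num_real//.
by rewrite -col_j (bigD1 i)//= lerDl sumr_ge0// => k _; exact: sqr_ge0.
Qed.

Lemma scalar_norm_bound (xi : {scalar 'cV[R]_m}) :
  exists2 C : R, 0 <= C &
    forall (z : 'cV[R]_m) (M : R), (forall r, `|z r 0| <= M) -> `|xi z| <= C * M.
Proof.
exists (\sum_r `|xi (delta_mx r 0)|); first by apply: sumr_ge0.
move=> z M zM; rewrite {1}[z]matrix_sum_delta linear_sum/= mulr_suml.
apply: le_trans (ler_norm_sum _ _ _) _; apply: ler_sum => r _.
by rewrite big_ord1 linearZ/= normrM mulrC ler_wpM2l.
Qed.

(** In a basis of the lattice, elements of the point group have integer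
    matrices, and orthogonality bounds their entries. *)
Lemma finite_point_group G : crystallographic G -> finite_set (point_group G).
Proof.
move=> [gG [b [fb LE]]].
pose K0 : R := \sum_(j < m) \sum_(r < m) `|(b`_j : 'cV[R]_m) r 0|.
have [C C0 CP] : exists2 C : R, 0 <= C & forall (i : 'I_m) (z : 'cV[R]_m) (M : R),
    0 <= M -> (forall r, `|z r 0| <= M) -> `|coord b i z| <= C * M.
  pose C i := sval (cid2 (scalar_norm_bound (coord b i))).
  have CP i := svalP (cid2 (scalar_norm_bound (coord b i))).
  exists (\sum_i C i); first by apply: sumr_ge0 => i _; have [] := CP i.
  move=> i z M M0 zM; have [_ /(_ z M zM) CM] := CP i; apply: le_trans CM _.
  apply: ler_wpM2r => //; rewrite (bigD1 i)//= lerDl.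
  by apply: sumr_ge0 => j _; have [] := CP j.
have K00 : 0 <= K0 by apply: sumr_ge0 => j _; apply: sumr_ge0.
pose N := Num.bound (C * K0).
(* The matrix, in the canonical basis, of the endomorphism with matrix A - N in
   the basis b; the shift by N makes the entries of A natural numbers. *)
pose f (A : 'M['I_(N + N).+1]_m) : 'M[R]_m := \matrix_(r, c)
  \sum_(j < m) coord b j (delta_mx c 0) *
    \sum_(i < m) ((A i j : nat)%:R - N%:R) * (b`_i : 'cV[R]_m) r 0.
apply: (@sub_finite_set _ _ (f @` [set: 'M['I_(N + N).+1]_m])); last first.
  by apply: finite_image; exact: finite_finset.
move=> d Jd; have [v g] := Jd; have od := group_orthogonal gG g.
have Kint (i j : 'I_m) : coord b i (d *m b`_j) \is a Num.int.
  apply: (iffLR (lattice_ofP _ fb)); rewrite -[lattice_of b]LE.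
  apply: (point_group_translations gG Jd); rewrite LE.
  exists (fun k => (k == j)%:Z); rewrite (bigD1 j)//= eqxx mulr1z big1 ?addr0//.
  by move=> k /negPf ->; rewrite mulr0z.
have Kbnd (i j : 'I_m) : `|coord b i (d *m b`_j)| < N%:R.
  apply: le_lt_trans (archi_boundP _); last by rewrite mulr_ge0.
  apply: CP => // r; rewrite mxE; apply: le_trans (ler_norm_sum _ _ _) _.
  rewrite /K0 [leRHS](bigD1 j)//=; apply: ler_wpDr.
    by apply: sumr_ge0 => k _; apply: sumr_ge0.
  apply: ler_sum => s _; rewrite normrM ler_piMl//.
  exact: orthogonal_entry_le1.
pose A : 'M['I_(N + N).+1]_m :=
  \matrix_(i, j) inord (absz (Num.floor (coord b i (d *m b`_j)) + N%:Z)).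
have AE i j : ((A i j : nat)%:R - N%:R : R) = coord b i (d *m b`_j).
  have := Kbnd i j; have /intrP[k kE] := Kint i j; rewrite mxE kE intrKfloor.
  rewrite ltr_norml => /andP[].
  rewrite -[N%:R]/(N%:Z%:~R) -mulrNz !ltr_int => kN1 kN2.
  have kN : 0 <= k + N%:Z by rewrite -lerBlDr sub0r ltW.
  rewrite inordK; last first.
    rewrite ltnS -lez_nat gez0_abs// PoszD.
    by rewrite lerD2r ltW.
  by rewrite -[X in X - _]/(_%:Z%:~R) gez0_abs// intrD addrK.
exists A => //; apply/matrixP => r c; rewrite mxE.
under eq_bigr do under eq_bigr do rewrite AE.
have -> : d r c = (d *m (delta_mx c 0 : 'cV_m)) r 0 by rewrite -colE mxE.
rewrite {2}(coord_expansion (delta_mx c 0) fb) mulmx_sumr summxE.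
apply: eq_bigr => j _; rewrite -scalemxAr mxE; congr (_ * _).
by rewrite {2}(coord_expansion (d *m b`_j) fb) summxE;
  apply: eq_bigr => i _; rewrite mxE.
Qed.

End CrystallographicGroups.

(** * Orbit sums and generic points *)

Section OrbitSums.
Variables (R : realType) (m : nat) (G : set ('cV[R]_m * 'M[R]_m)).
Hypothesis crysG : crystallographic G.
Let groupG := crysG.1.

(** Any choice will do: two representatives differ by a lattice vector, and the
    functions composed with them below are lattice-periodic. *)
Definition coset_rep (d : 'M[R]_m) : 'cV[R]_m := xget 0 [set v | G (v, d)].

Lemma coset_repP d : point_group G d -> G (coset_rep d, d).
Proof. by move=> [v g]; rewrite /coset_rep; case: xgetP => // /(_ v). Qed.

Lemma point_group_seq :
  exists2 s : seq 'M[R]_m, uniq s & forall d, d \in s <-> point_group G d.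
Proof.
have /finite_seqP[s sE] := finite_point_group crysG.
exists (undup s); first exact: undup_uniq.
by move=> d; rewrite mem_undup sE.
Qed.

Definition orbit_sum (s : seq 'M[R]_m) (k : 'cV[R]_m -> R) z : R :=
  \sum_(d <- s) k (coset_rep d + d *m z).

(** Composing with an element of the group permutes the cosets of its
    translation subgroup. *)
Lemma orbit_sum_invariant s k : uniq s ->
  (forall d, d \in s <-> point_group G d) ->
  (forall z l, translations G l -> k (z + l) = k z) ->
  forall g, G g -> forall z, orbit_sum s k (eact (einv g) z) = orbit_sum s k z.
Proof.
move=> us sJ kper [v d0] g z; rewrite /orbit_sum /eact /einv /=.
have J0 : point_group G d0 by exists v.
have u0 : d0 \in unitmx := orthogonal_unit (group_orthogonal groupG g).
have perm_s : perm_eq [seq d *m invmx d0 | d <- s] s.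
  have inj : injective (fun d : 'M[R]_m => d *m invmx d0).
    by move=> d d' /(congr1 (mulmxr d0)) /=; rewrite !mulmxKV.
  apply: uniq_perm => //; first by rewrite map_inj_uniq.
  move=> d; apply/mapP/idP => [[d' /sJ Jd' ->]|/sJ Jd].
    by apply/sJ; apply: point_groupM => //; exact: point_groupV.
  by exists (d *m d0); [apply/sJ; exact: point_groupM|rewrite mulmxK].
rewrite -[RHS](perm_big _ perm_s) big_map !big_seq; apply: eq_bigr => d /sJ Jd.
have Jdd : point_group G (d *m invmx d0).
  by apply: point_groupM => //; exact: point_groupV.
have g1 := group_comp groupG (coset_repP Jd) (group_inv groupG g).
have := group_divr groupG g1 (coset_repP Jdd).
set w := coset_rep d + _ => Lw.
rewrite -[RHS](kper _ _ Lw); congr k.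
by rewrite mulmxDr addrA -/w mulmxA [RHS]addrAC [X in _ = X + _]addrC subrK.
Qed.

End OrbitSums.

Section GenericPoint.
Variables (R : realType) (n : nat).

Lemma uncountable_real : ~ countable [set: R].
Proof.
move=> /countable_lebesgue_measure0 mu0.
have : (lebesgue_measure `[0%R : R, 1%R] <= lebesgue_measure [set: R])%E.
  by apply: le_measure; rewrite ?inE.
by rewrite mu0 lebesgue_measure_itv/= lte_fin ltr01 oppr0 adde0 lee_fin ler10.
Qed.

Lemma finite_roots (p : {poly R}) : p != 0 -> finite_set [set s | root p s].
Proof.
move=> p0; apply: contrapT => /infiniteP/pcard_leP/injfunPex[f fr finj].
have /(_ _ _)/[!size_map]/[!size_iota]/[!ltnn] :=
  max_poly_roots (rs := [seq f i | i <- iota 0 (size p)]) p0.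
rewrite map_inj_in_uniq ?iota_uniq; last by move=> i j _ _; apply: finj; rewrite inE.
suff /[swap]/[apply]/(_ isT) : all (root p) [seq f i | i <- iota 0 (size p)] by [].
by apply/allP => _ /mapP[i _ ->]; exact: (fr i).
Qed.

(** Restricted to the curve (s, s^2, .., s^n), a nontrivial affine equation is a
    nonzero polynomial equation in s, so that countably many of them exclude only
    countably many points of the curve. *)
Lemma generic_point (T : countType) (M : T -> 'M[R]_n) (c : T -> 'cV[R]_n) :
  exists x : 'cV[R]_n, forall t, M t != 0 -> M t *m x != c t.
Proof.
pose x (s : R) : 'cV[R]_n := \col_j s ^+ j.+1.
pose bad t := [set s | M t != 0 /\ M t *m x s = c t].
have bad_fin t : countable (bad t).
  have [M0|M0] := eqVneq (M t) 0.
    rewrite (_ : bad t = set0); first exact: countable0.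
    by apply/seteqP; split=> // s []; rewrite M0 eqxx.
  have [i [j Mij]] : exists i j, M t i j != 0.
    apply: contrapT => Mij; case/eqP: M0; apply/matrixP => i j; rewrite mxE.
    by apply/eqP; apply/negP => /negP ?; apply: Mij; exists i, j.
  (* The curve starts at degree 1, so the constant term cannot cancel the others. *)
  pose p : {poly R} := \poly_(k < n.+1) (if k is k'.+1 then
    (if insub k' is Some j then M t i j else 0) else - c t i 0).
  have p0 : p != 0.
    apply/eqP => /(congr1 (fun q : {poly R} => q`_j.+1)).
    rewrite coef_poly coef0 ltnS ltn_ord valK => /eqP; exact/negP.
  apply: finite_set_countable.
  apply: sub_finite_set (finite_roots p0) => s [_ Ms] /=.
  rewrite rootE horner_poly big_ord_recl/= expr0 mulr1.
  apply/eqP; have /matrixP/(_ i 0) := Ms; rewrite mxE => <-.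
  rewrite addrC; apply/eqP; rewrite subr_eq0; apply/eqP/eq_bigr => k _.
  by rewrite add0n valK mxE.
have [s sP] : exists s, ~ (\bigcup_t bad t) s.
  apply/existsNP => all_bad; apply: uncountable_real.
  rewrite (_ : setT = \bigcup_t bad t).
    by apply: bigcup_countable => //; exact: countableP.
  by apply/seteqP; split.
exists (x s) => t M0; apply/eqP => E; apply: sP; by exists t.
Qed.

End GenericPoint.

(** * Vertical lines and localization of bumps *)

Section VerticalPlanes.
Variables (R : realType) (n : nat).
Implicit Types (x p : 'cV[R]_n) (d : 'M[R]_(n + 1)).

Lemma ptD x y x' y' : pt x y + pt x' y' = pt (x + x') (y + y') :> 'cV[R]_(n + 1).
Proof. by rewrite /pt add_col_mx -raddfD. Qed.

Lemma ptN x y : - pt x y = pt (- x) (- y) :> 'cV[R]_(n + 1).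
Proof. by rewrite /pt opp_col_mx -raddfN. Qed.

Lemma ptB x y x' y' : pt x y - pt x' y' = pt (x - x') (y - y') :> 'cV[R]_(n + 1).
Proof. by rewrite ptN ptD. Qed.

(** The diagonal of the Gram matrix consists of sums of squares. *)
Lemma gram_eq0 k l (A : 'M[R]_(k, l)) : A^T *m A = 0 -> A = 0.
Proof.
move=> /matrixP AA; apply/matrixP => i j; rewrite mxE.
have := AA j j; rewrite !mxE; under eq_bigr do rewrite mxE -expr2.
move=> /eqP; rewrite psumr_eq0 => [/allP/(_ i (mem_index_enum i))|r _].
  by rewrite sqrf_eq0 => /eqP.
exact: sqr_ge0.
Qed.

Lemma orthogonal_trmx d : orthogonal_mx d -> orthogonal_mx d^T.
Proof. by move=> od; rewrite /orthogonal_mx trmxK; exact: mulmx1C. Qed.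

(** Rows and columns of an orthogonal matrix have norm 1, so an identity block
    leaves no room next to it. *)
Lemma orthogonal_ul1 d : orthogonal_mx d -> ulsubmx d = 1%:M ->
  d = 1%:M \/ d = sigma.
Proof.
move=> od d1; have := submxK d; rewrite d1.
move: (ursubmx d) (dlsubmx d) (drsubmx d) => B C D dE.
have := orthogonal_trmx od; have := od.
rewrite /orthogonal_mx trmxK -dE tr_block_mx !mulmx_block trmx1.
rewrite !mul1mx !mulmx1 (scalar_mx_block n 1 1).
move=> /eq_block_mx[E1 _ _ E2] /eq_block_mx[F1 _ _ F2].
have C0 : C = 0 by apply: gram_eq0; rewrite -[LHS](addKr 1%:M) E1 addNr.
have B0 : B = 0.
  apply: trmx_inj; rewrite trmx0; apply: gram_eq0.
  by rewrite trmxK -[LHS](addKr 1%:M) F1 addNr.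
move: E2; rewrite C0 B0 trmx0 mulmx0 add0r (mx11_scalar D) tr_scalar_mx.
rewrite -scalar_mxM -expr2 => /matrixP/(_ 0 0); rewrite !mxE eqxx => /eqP.
rewrite sqrf_eq1 => /predU1P[->|/eqP ->]; first by left.
by right.
Qed.

(** Solving for the horizontal coordinates turns the incidence of a lattice
    translate of (x, q) with the image of the line over x + p into an affine
    equation on x, which is trivial only if the upper left block of d is 1. *)
Lemma pt_line_eq d v l x p (y q : R) : orthogonal_mx d ->
  v + d *m pt (x + p) y - pt x q = l ->
  (1%:M - ulsubmx d^T) *m x = usubmx (d^T *m (l + pt 0 q - v)) - p.
Proof.
move=> od E; have {}E : d *m pt (x + p) y = l + pt 0 q - v + pt x 0.
  rewrite -E; have -> : pt x q = pt x 0 + pt 0 q :> 'cV[R]_(n + 1).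
    by rewrite ptD addr0 add0r.
  move: (d *m _) (pt x 0) (pt 0 q) => D X Q.
  by rewrite opprD addrA subrK [v + D]addrC addrAC addrK subrK.
have : pt (x + p) y = d^T *m (l + pt 0 q - v) + d^T *m pt x 0.
  by rewrite -mulmxDr -E mulmxA od mul1mx.
set V := d^T *m _; rewrite -[in d^T *m pt x 0](submxK d^T) mul_block_col.
move=> /(congr1 usubmx); rewrite raddfD/= !col_mxKu raddf0 mulmx0 addr0 => xE.
by rewrite mulmxBl mul1mx; apply/eqP; rewrite subr_eq addrAC -xE addrK.
Qed.

End VerticalPlanes.

Section Thin.
Variables (R : realType) (m : nat) (b : m.-tuple 'cV[R]_m).
Hypothesis fb : free b.

Lemma gap_gt0 z : ~ lattice_of b z -> 0 < lattice_gap b z.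
Proof.
move=> Lz; rewrite lt_neqAle lattice_gap_ge0 andbT eq_sym.
by apply/eqP => /(lattice_gap_eq0 _ fb).
Qed.

(** Smallness conditions on the width e of a bump are expressed with the filter of
    positive numbers near 0, which combines finitely many of them. *)
Lemma thin_point z :
  \forall e \near (0 : R)^'+, ~ lattice_of b z -> e <= lattice_gap b z.
Proof.
have [Lz|Lz] := pselect (lattice_of b z); first by near=> e.
near=> e => _; near: e; apply: nbhs_right_le; exact: gap_gt0.
Unshelve. all: by end_near. Qed.

Lemma near_all (T : eqType) (s : seq T) (P : T -> R -> Prop) :
  (forall t, t \in s -> \forall e \near (0 : R)^'+, P t e) ->
  \forall e \near (0 : R)^'+, forall t, t \in s -> P t e.
Proof.
elim: s => [|t s IHs] Pnear; first by near=> e => t; rewrite in_nil.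
have Pt := Pnear t (mem_head _ _).
have {IHs} Ps := IHs (fun u us => Pnear u (@mem_behead _ (t :: s) u us)).
near=> e => u; rewrite inE => /predU1P[->|]; first by near: e.
by move: u; near: e.
Unshelve. all: by end_near. Qed.

Lemma bump_thin e z : e <= lattice_gap b z -> periodic_bump b e z = 0.
Proof. by move=> ez; rewrite /periodic_bump pos_sq_le0 ?mulr0// subr_le0. Qed.

Lemma bump_slope_thin e w z : e <= lattice_gap b z -> bump_slope b e w z = 0.
Proof.
by move=> ez; rewrite /bump_slope pos_sq_le0 ?mulr0 ?mul0r ?oppr0// subr_le0.
Qed.

Lemma bump_bracket e z : 0 < e -> (~ lattice_of b z -> e <= lattice_gap b z) ->
  periodic_bump b e z = e ^+ 3 * (`[< lattice_of b z >])%:R.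
Proof.
move=> e0 ez; case: asboolP => Lz; last by rewrite bump_thin ?mulr0//; exact: ez.
rewrite /periodic_bump ((lattice_gap_eq0 _ fb).2 Lz) subr0 /pos_sq max_r ?ltW//.
by rewrite mulr1 -exprS.
Qed.

End Thin.

Section ThinCurve.
Variables (R : realType) (n : nat) (b : (n + 1).-tuple 'cV[R]_(n + 1)).
Hypothesis fb : free b.

(** By compactness, the gap has a positive minimum on a segment that avoids the
    lattice. *)
Lemma thin_line (c : 'cV[R]_(n + 1)) d (x : 'cV[R]_n) (y0 : R) : 0 < y0 ->
  (forall y, ~ lattice_of b (c + d *m pt x y)) ->
  \forall e \near (0 : R)^'+, forall y, `[0, y0]%classic y ->
    e <= lattice_gap b (c + d *m pt x y).
Proof.
move=> y00 NL.
have cgap : continuous (fun y : R => lattice_gap b (c + d *m pt x y)).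
  have -> : (fun y : R => lattice_gap b (c + d *m pt x y)) =
      (fun y => lattice_gap b ((c + d *m pt x 0) + y *: (d *m pt 0 1))).
    by apply/funext => y; rewrite pt_line mulmxDr addrA -scalemxAr.
  move=> y; apply/differentiable_continuous/derivable1_diffP.
  by have [] := is_derive_gap b (c + d *m pt x 0) (d *m pt 0 1) y.
have [t _ tmin] := EVT_min (ltW y00) (continuous_subspaceT cgap).
near=> e => y /= yI; apply: le_trans (tmin y yI).
near: e; apply: nbhs_right_le; exact: gap_gt0.
Unshelve. all: by end_near. Qed.

End ThinCurve.

(** * Group elements that preserve the vertical direction *)

Section VerticalElements.
Variables (R : realType) (n : nat).
Variable G : set ('cV[R]_(n + 1) * 'M[R]_(n + 1)).
Hypothesis crysG : crystallographic G.
Let groupG := crysG.1.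
Let L := translations G.

Definition reflections : set 'cV[R]_(n + 1) := [set v | G (v, sigma)].

Lemma one_neq_sigma : 1%:M != sigma :> 'M[R]_(n + 1).
Proof.
apply/eqP; rewrite /sigma (scalar_mx_block n 1 1) => /eq_block_mx[_ _ _].
by move=> /matrixP/(_ 0 0); rewrite !mxE eqxx !mulr1n => ?; lra.
Qed.

Lemma coset_rep1 : L (coset_rep G 1%:M).
Proof. by apply: coset_repP; exists 0; case: groupG. Qed.

Lemma invmx_sigma : invmx sigma = sigma :> 'M[R]_(n + 1).
Proof.
have ss : sigma *m sigma = 1%:M :> 'M[R]_(n + 1).
  rewrite /sigma mulmx_block !mulmx0 !mul0mx !mulmx1 !addr0 add0r.
  by rewrite -scalar_mxM mulrNN mulr1 -scalar_mx_block.
have [us _] := mulmx1_unit ss.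
by rewrite -[RHS](mulKmx us) ss mulmx1.
Qed.

Lemma reflectionsN v : reflections v -> reflections (- (sigma *m v)).
Proof. by move=> /(group_inv groupG); rewrite invmx_sigma. Qed.

Lemma reflections_pt (p : 'cV[R]_n) (y : R) :
  reflections (pt p y) <-> reflections (pt (- p) y).
Proof.
suff H q : reflections (pt q y) -> reflections (pt (- q) y).
  by split=> [/H//|/H]; rewrite opprK.
by move=> /reflectionsN; rewrite sigma_pt ptN opprK.
Qed.

(** This turns the position of a lattice relative to a representative of sigma
    into a condition on the group alone. *)
Lemma coset_rep_sigma v : point_group G sigma ->
  L (coset_rep G sigma + v) <-> reflections (- v).
Proof.
move=> /(coset_repP) gw; split=> [Lv|rv].
  have := group_translate groupG (translationsN groupG Lv) gw.
  by rewrite opprD addNKr.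
by have := group_divr groupG gw rv; rewrite opprK.
Qed.

(** What is avoided is a countable union of affine conditions on x, by
    [pt_line_eq]; each is nontrivial because, by [orthogonal_ul1], only 1 and
    sigma have an identity upper left block. *)
Lemma generic_line (s : seq 'M[R]_(n + 1)) (p : 'cV[R]_n) (q : R) :
  (forall d, d \in s -> point_group G d) ->
  exists x : 'cV[R]_n, forall d, d \in s -> d != 1%:M -> d != sigma ->
    forall y, ~ L (coset_rep G d + d *m pt x y - pt x q) /\
              ~ L (coset_rep G d + d *m pt (x + p) y - pt x q).
Proof.
move=> sJ; have [b [fb LE]] := crysG.2.
pose M (t : nat * {ffun 'I_(n + 1) -> int} * bool) : 'M[R]_n :=
  1%:M - ulsubmx (nth 1%:M s t.1.1)^T.
pose shift (t : bool) := if t then p else 0.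
pose c (t : nat * {ffun 'I_(n + 1) -> int} * bool) : 'cV[R]_n :=
  usubmx ((nth 1%:M s t.1.1)^T *m (\sum_(i < n + 1) b`_i *~ t.1.2 i + pt 0 q
    - coset_rep G (nth 1%:M s t.1.1))) - shift t.2.
have [x xP] := generic_point M c.
exists x => d ds d1 dsig.
have od : orthogonal_mx d := group_orthogonal groupG (coset_repP (sJ d ds)).
have Md : 1%:M - ulsubmx d^T != 0.
  rewrite subr_eq0 eq_sym; apply/eqP => /(orthogonal_ul1 (orthogonal_trmx od)).
  case=> /(congr1 trmx); rewrite trmxK ?trmx1 => dE; first by rewrite dE eqxx in d1.
  move: dsig; rewrite dE /sigma tr_block_mx !trmx0 !tr_scalar_mx.
  by rewrite eqxx.
have NL (t : bool) y : ~ L (coset_rep G d + d *m pt (x + shift t) y - pt x q).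
  rewrite /L LE => -[k kE].
  have := pt_line_eq od kE; apply/eqP.
  have := xP (index d s, [ffun i => k i], t).
  rewrite /M /c /= nth_index// => /(_ Md).
  by under eq_bigr do rewrite ffunE.
by move=> y; have := NL true y; have := NL false y; rewrite /shift addr0.
Qed.

End VerticalElements.

(** * Endpoints of vertical segments *)

Section EndpointCount.
Variables (R : realType) (n : nat).
Variables (G : set ('cV[R]_(n + 1) * 'M[R]_(n + 1))) (y0 : R).
Hypotheses (crysG : crystallographic G) (y0_gt0 : 0 < y0).
Let groupG := crysG.1.
Let L := translations G.
Local Notation mu := (@lebesgue_measure R).

(** The factor k = 1 or -1 says whether the segment is traversed upwards, as with
    the linear part 1, or downwards, as with sigma. *)
Lemma Rintegral_bump_slope (b : (n + 1).-tuple 'cV[R]_(n + 1)) e c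
    (d : 'M[R]_(n + 1)) (x : 'cV[R]_n) (k : R) :
  k ^+ 2 = 1 -> d *m pt 0 1 = k *: pt 0 1 ->
  Rintegral mu `[0, y0] (fun y => bump_slope b e (pt 0 1) (c + d *m pt x y)) =
  k * (periodic_bump b e (c + d *m pt x y0) -
       periodic_bump b e (c + d *m pt x 0)).
Proof.
move=> k2 dk; have lineE (y : R) :
    c + d *m pt x y = (c + d *m pt x 0) + y *: (d *m pt 0 1).
  by rewrite pt_line mulmxDr addrA -scalemxAr.
rewrite mulrBr; pose F y := k * periodic_bump b e (c + d *m pt x y).
pose f y := bump_slope b e (pt 0 1) (c + d *m pt x y).
apply: (@Rintegral_derivative R F f 0 y0 y0_gt0).
  move=> y; rewrite /F /f; rewrite (_ : (fun y => _) = (fun y => k * periodic_bump b e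
      (c + d *m pt x 0 + y *: (d *m pt 0 1)))).
    have dbump := is_derive_bump b e (c + d *m pt x 0) (d *m pt 0 1) y.
    apply: is_derive_eq; rewrite -lineE /GRing.scale /= /bump_slope dk.
    rewrite (_ : slope b (k *: pt 0 1) _ = k * slope b (pt 0 1) (c + d *m pt x y)).
      by rewrite -[RHS]mul1r -k2; ring.
    by rewrite /slope mulr_sumr; apply: eq_bigr => i _; rewrite linearZ/=; ring.
  by apply/funext => t; rewrite lineE.
exact: (continuous_vertical (C1_continuous (C1_bump_slope b c d e (pt 0 1)))).
Qed.

(** Composition with affine maps is asked for because orbit sums compose a test
    function with the elements of the group. *)
Definition affinely_C1 (k : 'cV[R]_(n + 1) -> R) : Prop :=
  forall c (d : 'M[R]_(n + 1)), is_C1 (fun z : 'cV[R]_(n + 1) => k (c + d *m z)).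

Lemma near_right_ex (P : set R) : (\forall e \near (0 : R)^'+, P e) ->
  exists e : R, 0 < e /\ P e.
Proof.
move=> nP; have nP0 : \forall e \near (0 : R)^'+, 0 < e by exact: nbhs_right_gt.
exact: (filter_ex (filterI nP0 nP)).
Qed.

Lemma orbit_sum_in s (k : 'cV[R]_(n + 1) -> R) : uniq s ->
  (forall d, d \in s <-> point_group G d) ->
  affinely_C1 k ->
  (forall z l, L l -> k (z + l) = k z) ->
  invariant_functions G (orbit_sum G s k).
Proof.
move=> us sJ C1k kper; split; first by apply: C1_sum => d; exact: C1k.
by move=> g Gg z; exact: orbit_sum_invariant.
Qed.

Lemma projection_orbit_sum s (k : 'cV[R]_(n + 1) -> R) x :
  affinely_C1 k ->
  projection y0 (orbit_sum G s k) x =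
  \sum_(d <- s) Rintegral mu `[0, y0] (fun y => k (coset_rep G d + d *m pt x y)).
Proof.
move=> C1k; apply: Rintegral_sum_continuous => d.
exact: (continuous_vertical (C1_continuous (C1k _ _))).
Qed.

Lemma period_orbit_sum s k p x : uniq s ->
  (forall d, d \in s <-> point_group G d) ->
  affinely_C1 k ->
  (forall z l, L l -> k (z + l) = k z) -> periods y0 G p ->
  \sum_(d <- s) Rintegral mu `[0, y0]
    (fun y => k (coset_rep G d + d *m pt (x + p) y)) =
  \sum_(d <- s) Rintegral mu `[0, y0]
    (fun y => k (coset_rep G d + d *m pt x y)).
Proof.
move=> us sJ C1k kper pp; rewrite -!projection_orbit_sum//; apply: pp.
by exists (orbit_sum G s k) => //; exact: orbit_sum_in.
Qed.

Lemma Rintegral_eq0 (f : R -> R) (a b : R) :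
  (forall y, `[a, b]%classic y -> f y = 0) -> Rintegral mu `[a, b] f = 0.
Proof.
move=> f0; rewrite (_ : Rintegral _ _ _ = Rintegral mu `[a, b] (cst 0)).
  by rewrite Rintegral_cst// mul0r.
by apply: eq_Rintegral => y; rewrite inE => /f0.
Qed.

Lemma sum_indicator (T : eqType) (s : seq T) (a : T) (c : R) : uniq s ->
  \sum_(t <- s) (t == a)%:R * c = (a \in s)%:R * c.
Proof.
elim: s => [|t s IHs] /=; first by rewrite big_nil mul0r.
move=> /andP[ts us]; rewrite big_cons IHs// inE [a == t]eq_sym.
by have [<-|_] := eqVneq t a; rewrite ?(negPf ts) mul0r ?addr0 ?add0r.
Qed.

Lemma bump_slope_C1_shift (b : (n + 1).-tuple 'cV[R]_(n + 1)) e w z0 c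
    (d : 'M[R]_(n + 1)) :
  is_C1 (fun z : 'cV[R]_(n + 1) => bump_slope b e w (c + d *m z - z0)).
Proof.
rewrite (_ : (fun z => _) = fun z => bump_slope b e w ((c - z0) + d *m z)).
  exact: C1_bump_slope.
by apply/funext => z; rewrite addrAC.
Qed.

Lemma pos_gap_C1_shift (b : (n + 1).-tuple 'cV[R]_(n + 1)) e z0 c
    (d : 'M[R]_(n + 1)) :
  is_C1 (fun z : 'cV[R]_(n + 1) => pos_sq (e - lattice_gap b (c + d *m z - z0))).
Proof.
rewrite (_ : (fun z => _) = fun z => pos_sq (e - lattice_gap b ((c - z0) + d *m z))).
  exact: C1_pos_gap.
by apply/funext => z; rewrite addrAC.
Qed.

Definition truth (P : Prop) : R := (`[< P >])%:R.

(** The contribution of the vertical segment over x + p to the integral of the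
    vertical derivative of a bump at (x, q), for a bump of height 1: each endpoint
    counts positively or negatively according to its position on the image of
    the segment, whose orientation sigma reverses. *)
Definition endpoint_count (p : 'cV[R]_n) (q : R) : R :=
  truth (L (pt p (y0 - q))) - truth (L (pt p (- q)))
  + truth (reflections G (pt p q)) - truth (reflections G (pt p (y0 + q))).

(** Only the linear parts 1 and sigma contribute for generic x, and their
    contributions are the values at the endpoints of a bump of height e^3. *)
Lemma endpoint_count_period p q : periods y0 G p ->
  endpoint_count p q = endpoint_count 0 q.
Proof.
move=> pp; have [s us sJ] := point_group_seq crysG.
have [b [fb LE]] := crysG.2.
have [x xP] := generic_line crysG p q (fun d => (sJ d).1).
pose line d p' t := coset_rep G d + d *m pt (x + p') t - pt x q.
have lineE d p' t : line d p' t = (coset_rep G d - pt x q) + d *m pt (x + p') t.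
  by rewrite /line addrAC.
have line1 p' t : L (line 1%:M p' t) <-> L (pt p' (t - q)).
  rewrite /line mul1mx -addrA ptB [x + p']addrC addrK.
  split=> Lz; last exact: translationsD groupG _ _ (coset_rep1 crysG) Lz.
  by have := translationsB groupG Lz (coset_rep1 crysG); rewrite (addrC (_ + _)) addKr.
have lines p' t : point_group G sigma ->
    L (line sigma p' t) <-> reflections G (pt p' (t + q)).
  move=> Js; rewrite /line sigma_pt -addrA ptB [x + p']addrC addrK.
  apply: iff_trans (coset_rep_sigma crysG _ Js) _.
  rewrite ptN opprB opprK [q + t]addrC; apply: iff_sym; exact: reflections_pt.
have [e [e0 e_line e_pts]] : exists e : R, [/\ 0 < e,
    forall d, d \in s -> d != 1%:M -> d != sigma -> forall p', p' \in [:: 0; p] ->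
      forall y, `[0, y0]%classic y -> e <= lattice_gap b (line d p' y) &
    forall d, d \in [:: 1%:M; sigma] -> forall p', p' \in [:: 0; p] ->
      forall t, t \in [:: 0; y0] ->
        ~ lattice_of b (line d p' t) -> e <= lattice_gap b (line d p' t)].
  have near_line : \forall e \near (0 : R)^'+, forall d, d \in s ->
      forall p', p' \in [:: 0; p] -> d != 1%:M -> d != sigma ->
      forall y, `[0, y0]%classic y -> e <= lattice_gap b (line d p' y).
    apply: near_all => d ds; apply: near_all => p' p'P.
    have [d1|d1] := eqVneq d 1%:M; first by near=> e.
    have [dsig|dsig] := eqVneq d sigma; first by near=> e.
    have NL y : ~ lattice_of b (coset_rep G d - pt x q + d *m pt (x + p') y).
      rewrite -lineE; have [] := xP d ds d1 dsig y.
      by move: p'P; rewrite /L LE /line !inE => /orP[] /eqP ->; rewrite ?addr0.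
    have := thin_line fb y0_gt0 NL; apply: filterS => e eL _ _ y yI.
    by rewrite lineE; exact: eL.
  have near_pts : \forall e \near (0 : R)^'+, forall d, d \in [:: 1%:M; sigma] ->
      forall p', p' \in [:: 0; p] -> forall t, t \in [:: 0; y0] ->
      ~ lattice_of b (line d p' t) -> e <= lattice_gap b (line d p' t).
    apply: near_all => d _; apply: near_all => p' _; apply: near_all => t _.
    exact: thin_point.
  have [e [e0 [el ep]]] := near_right_ex (filterI near_line near_pts).
  exists e; split=> //.
  by move=> d ds d1 dsig p' p'P; exact: el.
pose k z := bump_slope b e (pt 0 1) (z - pt x q).
have C1k : affinely_C1 k by move=> c d; exact: bump_slope_C1_shift.
have kper z l : L l -> k (z + l) = k z.
  rewrite /L LE => Ll; rewrite /k /bump_slope addrAC.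
  by rewrite lattice_gapD// slopeD.
have [in1 ins] : (1%:M : 'M[R]_(n + 1)) \in [:: 1%:M; sigma] /\
    sigma \in [:: 1%:M; sigma : 'M[R]_(n + 1)] by split; rewrite !inE eqxx ?orbT.
have [in0 iny0] : 0 \in [:: 0; y0] /\ y0 \in [:: 0; y0].
  by split; rewrite !inE eqxx ?orbT.
have bracket d p' t : d \in [:: 1%:M; sigma] -> p' \in [:: 0; p] ->
    t \in [:: 0; y0] ->
    periodic_bump b e (line d p' t) = e ^+ 3 * truth (L (line d p' t)).
  by move=> dP p'P tP; rewrite bump_bracket// /truth /L ?LE//; exact: e_pts.
(* The integral over the segment above x + p' retains two terms of the orbit sum. *)
have total p' : p' \in [:: 0; p] -> \sum_(d <- s) Rintegral mu `[0, y0]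
    (fun y => k (coset_rep G d + d *m pt (x + p') y)) =
    e ^+ 3 * endpoint_count p' q.
  move=> p'P; pose A := e ^+ 3 * (truth (L (pt p' (y0 - q))) - truth (L (pt p' (- q)))).
  pose B := e ^+ 3 * (truth (reflections G (pt p' q)) -
                      truth (reflections G (pt p' (y0 + q)))).
  rewrite big_seq (eq_bigr (fun d => (d == 1%:M)%:R * A + (d == sigma)%:R * B)).
    rewrite -big_seq big_split/= !sum_indicator//.
    have -> : 1%:M \in s by apply/sJ; exists 0; case: groupG.
    have -> : (sigma \in s)%:R * B = B.
      have [ss|ss] := boolP (sigma \in s); first by rewrite mul1r.
      have nr v : `[< reflections G v >] = false.
        by apply/asboolPn => gv; case/negP: ss; apply/sJ; exists v.
      by rewrite /B /truth !nr subrr mulr0 mul0r.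
    by rewrite mul1r /A /B /endpoint_count; ring.
  move=> d ds; rewrite /k.
  under eq_Rintegral do rewrite addrAC.
  have [d1|d1] := eqVneq d 1%:M.
    rewrite d1 (negPf (one_neq_sigma R n)) mul0r addr0 mul1r.
    rewrite (@Rintegral_bump_slope _ _ _ _ _ (1)) ?expr1n// ?mul1mx ?scale1r//.
    rewrite -![_ + pt _ _]/(_ + pt (x + p') _).
    have E t : coset_rep G 1%:M - pt x q + pt (x + p') t = line 1%:M p' t.
      by rewrite lineE mul1mx.
    rewrite !E !bracket//.
    by rewrite mul1r -mulrBr; congr (_ * (_ - _)); rewrite /truth;
      rewrite (asbool_equiv_eq (line1 _ _))// sub0r.
  have [dsig|dsig] := eqVneq d sigma.
    have Js : point_group G sigma by apply/sJ; rewrite -dsig.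
    rewrite dsig mul0r add0r mul1r.
    rewrite (@Rintegral_bump_slope _ _ _ _ _ (-1)) ?sqrrN ?expr1n//; last first.
      by rewrite sigma_pt scaleN1r ptN oppr0.
    rewrite -!lineE !bracket//.
    rewrite mulN1r -mulrBr -mulrN opprB; congr (_ * (_ - _)); rewrite /truth;
      by rewrite (asbool_equiv_eq (lines _ _ Js))// add0r.
  rewrite !mul0r addr0; apply: Rintegral_eq0 => y yI.
  by rewrite -lineE; apply: bump_slope_thin; exact: e_line.
have e3 : e ^+ 3 != 0 by rewrite expf_neq0// gt_eqF.
have [pP p0] : p \in [:: 0; p] /\ 0 \in [:: 0; p].
  by split; rewrite !inE eqxx ?orbT.
apply: (mulfI e3); rewrite -(total p pP) -(total 0 p0) addr0.
exact: period_orbit_sum us sJ C1k kper pp.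
Unshelve. all: by end_near. Qed.

(** Otherwise, for generic x, no point of the orbit of (x, 0) lies over x + p, and
    the orbit sum of a thin nonnegative bump at (x, 0) has integral 0 over x + p
    but not over x. *)
Lemma vertical_translate p : periods y0 G p ->
  exists w, L (pt p w) \/ reflections G (pt p w).
Proof.
move=> pp; apply: contrapT => /forallNP none.
have NL w : ~ L (pt p w) by move=> Lw; apply: (none w); left.
have NS w : ~ reflections G (pt p w) by move=> Lw; apply: (none w); right.
have [s us sJ] := point_group_seq crysG.
have [b [fb LE]] := crysG.2.
have [x xP] := generic_line crysG p 0 (fun d => (sJ d).1).
have NLd d : d \in s -> forall y,
    ~ lattice_of b (coset_rep G d - pt x 0 + d *m pt (x + p) y).
  move=> ds y; rewrite -[lattice_of b]LE -/L addrAC.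
  have [->|d1] := eqVneq d 1%:M.
    rewrite mul1mx -addrA ptB [x + p]addrC addrK => Lz.
    have := translationsB groupG Lz (coset_rep1 crysG); rewrite (addrC (_ + _)) addKr.
    exact: NL.
  have [dsig|dsig] := eqVneq d sigma; last by have [] := xP d ds d1 dsig y.
  have Js : point_group G sigma by apply/sJ; rewrite -dsig.
  rewrite dsig sigma_pt -addrA ptB [x + p]addrC addrK.
  move=> /(coset_rep_sigma crysG _ Js); rewrite ptN => /(reflections_pt crysG).
  by rewrite opprK; exact: NS.
have near_line : \forall e \near (0 : R)^'+, forall d, d \in s ->
    forall y, `[0, y0]%classic y ->
    e <= lattice_gap b (coset_rep G d - pt x 0 + d *m pt (x + p) y).
  by apply: near_all => d ds; apply: thin_line => //; exact: NLd.
have [e [e0 eline]] := near_right_ex near_line.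
pose k z := pos_sq (e - lattice_gap b (z - pt x 0)).
have C1k : affinely_C1 k by move=> c d; exact: pos_gap_C1_shift.
have kper z l : L l -> k (z + l) = k z.
  by rewrite /L LE => Ll; rewrite /k addrAC lattice_gapD.
have k_ge0 z : 0 <= k z by exact: sqr_ge0.
pose I x' d := Rintegral mu `[0, y0] (fun y => k (coset_rep G d + d *m pt x' y)).
have int0 d : d \in s -> I (x + p) d = 0.
  move=> ds; apply: Rintegral_eq0 => y yI; rewrite /k pos_sq_le0// subr_le0 addrAC.
  exact: eline.
have sumE : \sum_(d <- s) I (x + p) d = \sum_(d <- s) I x d.
  exact: period_orbit_sum x us sJ C1k kper pp.
have sum0 : \sum_(d <- s) I x d == 0.
  by rewrite -sumE big_seq big1.
have I_ge0 d : 0 <= I x d by apply: Rintegral_ge0 => y _.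
have gap0 : lattice_gap b 0 = 0.
  by apply/(lattice_gap_eq0 _ fb); rewrite -[lattice_of b]LE; exact: translations0.
have k_gt0 : 0 < k (coset_rep G 1%:M + 1%:M *m pt x 0).
  rewrite mul1mx addrC kper; last exact: coset_rep1.
  rewrite /k subrr gap0 subr0 /pos_sq max_r; last exact: ltW.
  exact: exprn_gt0.
have I_gt0 : 0 < I x 1%:M.
  have kc : continuous (fun y : R => k (coset_rep G 1%:M + 1%:M *m pt x y)).
    exact: (continuous_vertical (C1_continuous (C1k _ _))).
  exact: Rintegral_gt0 y0_gt0 kc (fun=> k_ge0 _) k_gt0.
have s1 : 1%:M \in s by apply/sJ; exists 0; case: groupG.
move: sum0; rewrite psumr_eq0 => [/allP/(_ _ s1)/implyP/(_ isT)|d _].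
  by rewrite gt_eqF.
exact: I_ge0.
Qed.

End EndpointCount.

(** * Subgroups of finitely generated free groups *)

Section IntegerSubgroups.

(** The generator is the least positive element, if there is one. *)
Lemma int_subgroup (H : set int) : H 0 -> (forall i j, H i -> H j -> H (i - j)) ->
  exists d : int, forall i, H i <-> exists k, i = d * k.
Proof.
move=> H0 HB; have HN i : H i -> H (- i) by move=> Hi; rewrite -sub0r; exact: HB.
have HD i j : H i -> H j -> H (i + j).
  by move=> Hi /HN Hj; rewrite -[j]opprK; exact: HB.
have HM i k : H i -> H (i * k).
  move=> Hi; have HMn (n : nat) : H (i * n%:Z).
    elim: n => [|n IHn]; first by rewrite mulr0.
    by rewrite intS mulrDr mulr1; exact: HD.
  by case: k => n //; rewrite NegzE mulrN; apply: HN.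
have [[i [Hi i0]]|Hall] := pselect (exists i, H i /\ i != 0); last first.
  exists 0 => i; split=> [Hi|[k ->]]; last by rewrite mul0r.
  exists 0; rewrite mulr0; apply/eqP/negPn/negP => i0; apply: Hall; by exists i.
have ex : exists n : nat, (0 < n)%N && `[< H n%:Z >].
  exists (absz i); rewrite absz_gt0 i0; apply/asboolP.
  by case: (i) Hi => k // /HN; rewrite NegzE opprK.
case: (ex_minnP ex) => d /andP[d0 /asboolP Hd] dmin.
exists d%:Z => j; split=> [Hj|[k ->]]; last exact: HM.
exists (j %/ d)%Z; rewrite {1}(divz_eq j d) mulrC.
suff -> : (j %% d)%Z = 0 by rewrite addr0.
have Hm : H (j %% d)%Z by rewrite /modz mulrC; apply: HB => //; exact: HM.
have dnz : d%:Z != 0 by rewrite eqz_nat -lt0n.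
have m0 := modz_ge0 j dnz; have md := ltz_pmod j (d0 : 0 < d%:Z).
apply/eqP/negPn/negP => mnz.
have := dmin (absz (j %% d)%Z); rewrite absz_gt0 mnz gez0_abs// asboolT// => /(_ isT).
by rewrite -lez_nat gez0_abs// leNgt md.
Qed.

Variables (R : realType) (vT : vectType R).
Implicit Types (s c : seq vT) (H : set vT).

(** Integer combinations, in a recursive form suited to induction on s. *)
Fixpoint int_span s : set vT :=
  if s is x :: s' then [set v | exists k : int, int_span s' (v - x *~ k)]
  else [set 0].

Lemma int_span_subgroup s :
  int_span s 0 /\ forall u v, int_span s u -> int_span s v -> int_span s (u - v).
Proof.
elim: s => [|x s [IH0 IHB]] /=.
  by split=> // u v -> ->; rewrite subr0.
split; first by exists 0; rewrite mulr0z subr0.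
move=> u v [k uk] [l vl]; exists (k - l).
by rewrite mulrzBr opprB addrACA [- v + _]addrC addrACA -(opprB v); exact: IHB.
Qed.

Lemma int_span0 s : int_span s 0.
Proof. by case: (int_span_subgroup s). Qed.

Lemma int_spanB s u v : int_span s u -> int_span s v -> int_span s (u - v).
Proof. by case: (int_span_subgroup s) => _; exact. Qed.

Lemma int_span_mem s x : x \in s -> int_span s x.
Proof.
elim: s => //= y s IHs; rewrite inE => /predU1P[->|/IHs xs].
  by exists 1; rewrite mulr1z subrr; exact: int_span0.
by exists 0; rewrite mulr0z subr0.
Qed.

Lemma int_span_span s v : int_span s v -> v \in << s >>%VS.
Proof.
elim: s v => [v ->|x s IHs v [k /IHs vk]]; first exact: mem0v.
rewrite -(subrK (x *~ k) v) rpredD//.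
  by apply: subvP vk; apply: sub_span => y; rewrite inE => ->; rewrite orbT.
by apply: rpredMz; rewrite memv_span ?mem_head.
Qed.

Lemma int_spanE (m : nat) (b : m.-tuple vT) :
  int_span b = [set v | exists k : 'I_m -> int, v = \sum_(i < m) b`_i *~ k i].
Proof.
apply/seteqP; split=> v.
- elim: m b v => [|m IHm] b v.
    by rewrite tuple0 => ->; exists (fun=> 0); rewrite big_ord0.
  case/tupleP: b => x b /= [k /IHm[l vE]].
  exists (fun i => if unlift ord0 i is Some j then l j else k).
  rewrite big_ord_recl/= unlift_none -[LHS](subrK (x *~ k)) vE addrC.
  by congr (_ + _); apply: eq_bigr => i _; rewrite liftK.
- elim: m b v => [|m IHm] b v [k ->].
    by rewrite tuple0 big_ord0.
  case/tupleP: b => x b; rewrite big_ord_recl /=; exists (k ord0).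
  by rewrite addrC addKr; apply: IHm; exists (fun i => k (lift ord0 i)).
Qed.

(** By induction on the basis: the subgroup is an extension of the ideal of its
    first coordinates, which is principal, by a subgroup of the span of the
    remaining vectors. *)
Lemma free_subgroup_basis c H : free c -> H `<=` int_span c ->
  H 0 -> (forall u v, H u -> H v -> H (u - v)) ->
  exists s, free s /\ H = int_span s.
Proof.
elim: c H => [|x c IHc] H.
  move=> _ Hc H0 _; exists [::]; split; first exact: nil_free.
  by apply/seteqP; split=> // v ->.
rewrite free_cons => /andP[xc fc] Hc H0 HB.
have [] := IHc (H `&` int_span c) fc; first by move=> v [].
- by split=> //; exact: int_span0.
- by move=> u v [Hu cu] [Hv cv]; split; [exact: HB|exact: int_spanB].
move=> s [fs sE].
have [d dP] : exists d : int, forall i,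
    (exists v, H v /\ int_span c (v - x *~ i)) <-> exists k, i = d * k.
  apply: int_subgroup.
    by exists 0; rewrite mulr0z subr0; split; last exact: int_span0.
  move=> i j [u [Hu cu]] [v [Hv cv]]; exists (u - v); split; first exact: HB.
  by rewrite mulrzBr opprB addrACA [- v + _]addrC addrACA -(opprB v); exact: int_spanB.
have [h [Hh hd]] : exists v, H v /\ int_span c (v - x *~ d).
  by apply/dP; exists 1; rewrite mulr1.
have HM k : H (h *~ k).
  have HN v : H v -> H (- v) by move=> Hv; rewrite -sub0r; exact: HB.
  have HMn (n : nat) : H (h *+ n).
    elim: n => [|n IHn]; first by rewrite mulr0n.
    by rewrite mulrSr -[X in _ + X]opprK; apply: HB => //; exact: HN.
  by case: k => n; [exact: HMn|rewrite NegzE mulrNz; apply: HN; exact: HMn].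
have cM k : int_span c ((h - x *~ d) *~ k).
  have cN v : int_span c v -> int_span c (- v).
    by move=> cv; rewrite -sub0r; apply: int_spanB => //; exact: int_span0.
  have cMn (n : nat) : int_span c ((h - x *~ d) *+ n).
    elim: n => [|n IHn]; first by rewrite mulr0n; exact: int_span0.
    by rewrite mulrSr -[X in _ + X]opprK; apply: int_spanB => //; exact: cN.
  by case: k => n; [exact: cMn|rewrite NegzE mulrNz; apply: cN; exact: cMn].
have [d0|d0] := eqVneq d 0.
  exists s; split=> //; rewrite -sE; apply/seteqP; split=> [v Hv|v []//].
  split=> //; have /= [k vk] := Hc v Hv.
  have /dP[l kE] : exists v, H v /\ int_span c (v - x *~ k) by exists v.
  by move: vk; rewrite kE d0 mul0r mulr0z subr0.
exists (h :: s); split.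
  rewrite free_cons fs andbT; apply: contra xc => hs.
  have sc : (<< s >> <= << c >>)%VS.
    apply/span_subvP => y /int_span_mem; rewrite -sE => -[_].
    exact: int_span_span.
  have : x *~ d \in << c >>%VS.
    rewrite -[x *~ d](subKr h); apply: rpredB; first exact: (subvP sc).
    exact: int_span_span.
  by rewrite -scaler_int rpredZeq intr_eq0 (negPf d0).
apply/seteqP; split=> v /=.
  move=> Hv; have /= [k vk] := Hc v Hv.
  have /dP[l kE] : exists v, H v /\ int_span c (v - x *~ k) by exists v.
  exists l; rewrite -sE; split; first exact: HB.
  have -> : v - h *~ l = (v - x *~ k) - (h - x *~ d) *~ l.
    by rewrite kE mulrzBl mulrzA opprB addrA subrK.
  by apply: int_spanB.
move=> [k]; rewrite -sE => -[Hv _].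
have -> : v = (v - h *~ k) - (0 - h *~ k) by rewrite sub0r opprK subrK.
by apply: (HB _ _ Hv); exact: HB H0 (HM k).
Qed.

End IntegerSubgroups.

(** * The two kinds of periods *)

Lemma int_parity (k : int) : exists m : int, k = m * 2 \/ k = m * 2 + 1.
Proof.
exists (k %/ 2)%Z; have := divz_eq k 2; have := modz_ge0 k (isT : 2%:Z != 0).
have := ltz_pmod k (isT : (0 : int) < 2%:Z).
case: (k %% 2)%Z => [[|[|m]]|m] // _ _ kE.
  by left; rewrite {1}kE addr0.
by right; rewrite {1}kE.
Qed.

Section Vertical.
Variables (R : realType) (n : nat).

(** A nonzero coordinate of the vertical axis identifies the heights of the
    vertical vectors of L with a subgroup of the integers, generated by some d;
    there 2 t and 2 u are odd multiples of d, so that their difference is an even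
    one. *)
Lemma vertical_half (L : set 'cV[R]_(n + 1)) (t u : R) : is_lattice L ->
  L (pt 0 (t + t)) -> L (pt 0 (u + u)) -> ~ L (pt 0 t) -> ~ L (pt 0 u) ->
  L (pt 0 (t - u)).
Proof.
move=> [b [fb LE]] Lt Lu NLt NLu.
have coordL z : L z <-> forall i, coord b i z \is a Num.int.
  by rewrite LE; exact: lattice_ofP.
have vertE (r : R) i : coord b i (pt 0 r) = r * coord b i (pt 0 1).
  rewrite pt_line linearD linearZ/=.
  by rewrite (_ : pt 0 0 = 0) ?linear0 ?add0r// /pt raddf0 col_mx0.
have [i c0] : exists i, coord b i (pt 0 1) != 0.
  apply: contrapT => Nc.
  have e0 : pt 0 1 = 0 :> 'cV[R]_(n + 1).
    rewrite (coord_expansion (pt 0 1) fb) big1// => i _.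
    have [->|ci] := eqVneq (coord b i (pt 0 1)) 0; first by rewrite scale0r.
    by case: Nc; exists i.
  have := congr1 (fun z => dsubmx z 0 0) e0.
  by rewrite /pt col_mxKd !mxE eqxx => /eqP; rewrite oner_eq0.
set c := coord b i (pt 0 1) in c0.
pose H : set int := [set j | exists r, L (pt 0 r) /\ r * c = j%:~R].
have [d dP] : exists d : int, forall j, H j <-> exists k, j = d * k.
  apply: int_subgroup => [|j k [r [Lr rj]] [s [Ls sk]]].
    by exists 0; rewrite mul0r; split=> //; apply/coordL => k; rewrite vertE mul0r.
  exists (r - s); rewrite mulrBl rj sk intrB; split=> //.
  apply/coordL => k0; rewrite vertE mulrBl -!vertE.
  by apply: rpredB; [move/coordL: Lr|move/coordL: Ls].
have HL r : L (pt 0 r) -> exists k : int, r * c = (d * k)%:~R.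
  move=> Lr; have := (coordL _).1 Lr i; rewrite vertE => /intrP[j rj].
  have /dP[k jk] : H j by exists r.
  by exists k; rewrite -jk.
have LH r (k : int) : r * c = (d * k)%:~R -> L (pt 0 r).
  move=> rk; have [s [Ls sk]] : H (d * k) by apply/dP; exists k.
  by rewrite (mulIf c0 (etrans rk (esym sk))).
have odd r : L (pt 0 (r + r)) -> ~ L (pt 0 r) ->
    exists m : int, (r + r) * c = (d * (m * 2 + 1))%:~R.
  move=> /HL[k rk] NLr; have [m [kE|kE]] := int_parity k; last first.
    by exists m; rewrite -kE.
  case: NLr; apply: (LH _ m); move: rk; rewrite kE !intrM; lra.
have [p tp] := odd t Lt NLt; have [q uq] := odd u Lu NLu.
apply: (LH _ (p - q)); move: tp uq; rewrite !(intrM, intrB, intrD); lra.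
Qed.

End Vertical.

Section Dichotomy.
Variables (R : realType) (n : nat).
Variables (G : set ('cV[R]_(n + 1) * 'M[R]_(n + 1))) (y0 : R).
Hypotheses (crysG : crystallographic G) (y0_gt0 : 0 < y0).
Hypothesis y0_notin : ~ translations G (pt 0 y0).
Let groupG := crysG.1.
Let L := translations G.

Lemma pt00 : pt 0 0 = 0 :> 'cV[R]_(n + 1).
Proof. by rewrite /pt raddf0 col_mx0. Qed.

Lemma truth_T (P : Prop) : P -> truth R P = 1.
Proof. by move=> p; rewrite /truth asboolT. Qed.

Lemma truth_F (P : Prop) : ~ P -> truth R P = 0.
Proof. by move=> p; rewrite /truth asboolF. Qed.

Lemma truth_ge0 (P : Prop) : 0 <= truth R P.
Proof. exact: ler0n. Qed.

Lemma truth_le1 (P : Prop) : truth R P <= 1.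
Proof. by rewrite /truth; case: asboolP. Qed.

Lemma truth_gt0 (P : Prop) : 0 < truth R P -> P.
Proof. by rewrite /truth; case: asboolP => //; rewrite ltxx. Qed.

(** Supposing the contrary, the counts at q = 0 force (0, 0) to be a reflection,
    and those at q = y0 then force (0, 2 y0) to be one, hence to be in L.  In
    this case the counts carry no further information, and the height w given by
    [vertical_translate] is used instead. *)
Lemma period_dichotomy p : periods y0 G p ->
  L (pt p 0) \/ reflections G (pt p y0).
Proof.
move=> pp; apply: contrapT => /not_orP[NLp NSp].
have L0 : L (pt 0 0) by rewrite pt00; exact: translations0.
have NLy : ~ L (pt 0 (- y0)).
  by move=> /(translationsN groupG); rewrite ptN oppr0 opprK.
have := endpoint_count_period crysG y0_gt0 0 pp.
have := endpoint_count_period crysG y0_gt0 y0 pp.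
rewrite /endpoint_count -/L subrr subr0 oppr0 addr0 !(truth_T L0) !(truth_F NLp).
rewrite !(truth_F NSp) !(truth_F NLy) (truth_F y0_notin) => ct_y0 ct_0.
have S0 : reflections G (pt 0 0).
  apply: truth_gt0; move: ct_0.
  have := truth_ge0 (L (pt p y0)); have := truth_ge0 (reflections G (pt p 0)).
  have := truth_ge0 (reflections G (pt 0 y0)); lra.
have NSy : ~ reflections G (pt 0 y0).
  move=> /truth_T S1; move: ct_0; rewrite S1.
  have := truth_ge0 (L (pt p y0)); have := truth_ge0 (reflections G (pt p 0)).
  have := truth_le1 (reflections G (pt 0 0)); lra.
have S2 : reflections G (pt 0 (y0 + y0)).
  apply: truth_gt0; move: ct_y0; rewrite (truth_F NSy).
  have := truth_ge0 (L (pt p (- y0))).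
  have := truth_ge0 (reflections G (pt p (y0 + y0))); lra.
have L2 : L (pt 0 (y0 + y0)).
  by have := group_divr groupG S2 S0; rewrite pt00 subr0.
have SL v : reflections G v <-> L v.
  split=> [Sv|Lv]; first by have := group_divr groupG Sv S0; rewrite pt00 subr0.
  by have := group_translate groupG Lv S0; rewrite pt00 add0r.
have [w Lw] : exists w, L (pt p w).
  by have [w [Lw|/SL Lw]] := vertical_translate crysG y0_gt0 pp; exists w.
have Lw2 : L (pt 0 (w + w)).
  have Js : point_group G sigma by exists (pt 0 0).
  have := translationsB groupG Lw (point_group_translations groupG Js Lw).
  by rewrite sigma_pt ptB subrr opprK.
have NLw : ~ L (pt 0 w).
  move=> /(translationsB groupG Lw); rewrite ptB subr0 subrr; exact: NLp.
have := vertical_half crysG.2 L2 Lw2 y0_notin NLw.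
move=> /(translationsD groupG Lw); rewrite ptD addr0 addrC subrK => /SL.
exact: NSp.
Qed.

Lemma translation_period p : L (pt p 0) -> periods y0 G p.
Proof.
move=> Lp _ [f [_ finv] <-] x; apply: eq_Rintegral => y _.
have /finv/(_ (pt (x + p) y)) := Lp.
rewrite /eact /einv /= invmx1 !mul1mx ptN ptD oppr0 add0r.
by rewrite [- p + _]addrC addrK.
Qed.

Lemma reflection_period p : reflections G (pt p y0) -> periods y0 G p.
Proof.
move=> Sp _ [f [C1f finv] <-] x.
have cf : continuous (fun y : R => f (pt x y)).
  exact: (continuous_vertical (C1_continuous C1f)).
rewrite -[RHS](Rintegral_reflect y0_gt0 cf); apply: eq_Rintegral => y _.
have /finv/(_ (pt (x + p) y)) := Sp.
rewrite /eact /einv /= invmx_sigma !sigma_pt ptN opprK ptD.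
by rewrite [- p + _]addrC addrK => <-.
Qed.

End Dichotomy.

(** * Lattices from subgroups *)

Section Lattices.
Variable R : realType.

Lemma free_map_inv (aT rT : vectType R) (g : 'Hom(aT, rT)) (s : seq aT) :
  free [seq g x | x <- s] -> free s.
Proof.
elim: s => [|x s IHs] /=; first by rewrite !nil_free.
rewrite !free_cons => /andP[gx /IHs ->]; rewrite andbT.
by apply: contra gx => xs; rewrite -limg_span; exact: memv_img.
Qed.

Lemma int_span_map (aT rT : vectType R) (g : {additive aT -> rT}) (s : seq aT) :
  int_span [seq g x | x <- s] = g @` int_span s.
Proof.
elim: s => [|x s IHs] /=; apply/seteqP; split=> v.
- by move=> ->; exists 0 => //; rewrite raddf0.
- by move=> [u -> <-]; rewrite raddf0.
- move=> [k]; rewrite IHs => -[u su uE]; exists (u + x *~ k).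
    by exists k; rewrite addrK.
  by rewrite raddfD raddfMz uE subrK.
- move=> [u [k uk] <-]; exists k; rewrite IHs; exists (u - x *~ k) => //.
  by rewrite raddfB raddfMz.
Qed.

Lemma is_latticeP (m : nat) (L : set 'cV[R]_m) :
  is_lattice L <-> exists s : seq 'cV[R]_m,
    [/\ free s, << s >>%VS = fullv & L = int_span s].
Proof.
split=> [[b [fb ->]]|[s [fs sfull LE]]].
  exists b; split=> //; last by rewrite int_spanE.
  apply/eqP; rewrite eqEsubv subvf /=; apply/subvP => z _.
  rewrite (coord_expansion z fb); apply: rpred_sum => i _.
  by rewrite rpredZ// memv_span// mem_nth// size_tuple.
have ss : size s == m.
  move: fs; rewrite /free sfull => /eqP <-.
  by rewrite dimvf dim_matrix mulr1.
exists (Tuple ss); split=> //.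
by rewrite LE -(int_spanE (Tuple ss)).
Qed.

(** H lies between L and the lattice of halves of L. *)
Lemma lattice_overgroup (m : nat) (L H : set 'cV[R]_m) : is_lattice L ->
  L `<=` H -> (forall v, H v -> L (v + v)) -> additive_subgroup H ->
  is_lattice H.
Proof.
move=> /is_latticeP[s [fs sfull LE]] LH H2 [H0 HB].
pose c := [seq 2^-1 *: x | x <- s].
pose g : 'End('cV[R]_m) := 2 *: \1%VF.
have gE v : g v = v + v by rewrite scale_lfunE id_lfunE scaler_nat mulr2n.
have c2 : [seq g x | x <- c] = s.
  rewrite -map_comp -[RHS]map_id; apply: eq_map => x /=.
  by rewrite gE -scalerDl -[RHS]scale1r; congr (_ *: _); lra.
have fc : free c by apply: (@free_map_inv _ _ g); rewrite c2.
have Hc : H `<=` int_span c.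
  move=> v /H2; rewrite LE -c2 (int_span_map g) => -[u cu uv].
  have {}uv : u + u = v + v by rewrite -gE.
  suff -> : v = u by [].
  apply: (@scalerI _ _ (2 : R)); first by rewrite pnatr_eq0.
  by rewrite !scaler_nat !mulr2n uv.
have [t [ft HE]] := free_subgroup_basis fc Hc H0 HB.
apply/is_latticeP; exists t; split=> //.
apply/eqP; rewrite eqEsubv subvf -sfull /=; apply/span_subvP => x xs.
by apply: int_span_span; rewrite -HE; apply: LH; rewrite LE; exact: int_span_mem.
Qed.

Lemma pt_split (n : nat) (z : 'cV[R]_(n + 1)) : z = pt (usubmx z) (dsubmx z 0 0).
Proof. by rewrite /pt -mx11_scalar vsubmxK. Qed.

(** Freeness comes from the ambient lattice, and rank n from the vectors
    v + sigma v, whose horizontal parts are twice those of the v in L. *)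
Lemma slice_lattice (n : nat) (L : set 'cV[R]_(n + 1)) : is_lattice L ->
  (forall v, L v -> L (sigma *m v)) -> is_lattice (slice 0 L).
Proof.
move=> /is_latticeP[b [fb bfull LE]] Lsigma.
have [L0 LB] : L 0 /\ forall u v, L u -> L v -> L (u - v).
  by rewrite LE; exact: int_span_subgroup.
have [s [fs sE]] := @free_subgroup_basis _ _ b [set v | L v /\ dsubmx v = 0] fb
  ltac:(move=> v []; rewrite LE//) ltac:(by split=> //; rewrite raddf0)
  ltac:(move=> u v [Lu u0] [Lv v0]; split; [exact: LB|by rewrite raddfB/= u0 v0 subrr]).
have sliceE : slice 0 L = int_span [seq usubmx x | x <- s].
  rewrite (int_span_map usubmx) -sE; apply/seteqP; split=> x.
    move=> Lx; exists (pt x 0); last exact: col_mxKu.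
    by split=> //; rewrite /pt col_mxKd raddf0.
  by move=> [v [Lv v0] <-]; rewrite /slice /= /pt raddf0 -v0 vsubmxK.
apply/is_latticeP; exists [seq usubmx x | x <- s]; split=> //.
  apply: (@free_map_inv _ _ (linfun (mulmx (col_mx 1%:M 0 : 'M[R]_(n + 1, n))))).
  rewrite -map_comp (_ : map _ s = s)//.
  rewrite -[RHS]map_id; apply/eq_in_map => x /int_span_mem; rewrite -sE => -[_ x0].
  by rewrite /= lfunE/= mul_col_mx mul1mx mul0mx -x0 vsubmxK.
apply/eqP; rewrite eqEsubv subvf /=; apply/subvP => x _.
(* The horizontal part of a basis vector v is half that of v + sigma v. *)
have usub_in y : y \in << b >>%VS -> usubmx y \in <<[seq usubmx x | x <- s] >>%VS.
  move=> yb.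
  have := memv_img (linfun (@usubmx R n 1 1)) yb; rewrite lfunE limg_span.
  apply: subvP; apply/span_subvP => _ /mapP[v vb ->]; rewrite lfunE/=.
  have Lv : L v by rewrite LE; exact: int_span_mem.
  have vE : v - - (sigma *m v) = pt (usubmx v + usubmx v) 0.
    by rewrite opprK {1 2}(pt_split v) sigma_pt ptD subrr.
  have : int_span [seq usubmx x | x <- s] (usubmx v + usubmx v).
    rewrite -sliceE /slice /= -vE; apply: (LB _ _ Lv).
    by rewrite -sub0r; apply: (LB _ _ L0); exact: Lsigma.
  move=> /int_span_span; rewrite -mulr2n -scaler_nat rpredZeq.
  by rewrite pnatr_eq0.
by have := usub_in (pt x 0); rewrite /pt col_mxKu bfull memvf; exact.
Qed.

End Lattices.

(** * The group of periods and the sheared lattice *)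

Section PeriodGroup.
Variables (R : realType) (n : nat).
Variables (G : set ('cV[R]_(n + 1) * 'M[R]_(n + 1))) (y0 : R).

Lemma periods_subgroup : additive_subgroup (periods y0 G).
Proof.
split=> [g _ x|p q pp qq g gP x]; first by rewrite addr0.
by rewrite [p - q]addrC addrA (pp g gP) -(qq g gP) subrK.
Qed.

Hypotheses (crysG : crystallographic G) (y0_gt0 : 0 < y0).
Hypothesis y0_notin : ~ translations G (pt 0 y0).
Let groupG := crysG.1.

Lemma periods_no_reflection :
  (forall v, ~ G (pt v y0, sigma)) -> periods y0 G = slice 0 (translations G).
Proof.
move=> noS; apply/seteqP; split=> p.
  by move=> /(period_dichotomy crysG y0_gt0 y0_notin)[//|/noS].
exact: translation_period.
Qed.

Lemma periods_reflection v1 : G (pt v1 y0, sigma) ->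
  periods y0 G = Zspan (slice 0 (translations G) `|` [set v1]).
Proof.
move=> S1; apply/seteqP; split=> p.
  move=> /(period_dichotomy crysG y0_gt0 y0_notin)[Lp|Sp] H [[H0 HB] sH].
    by apply: sH; left.
  have HD u v : H u -> H v -> H (u + v).
    by move=> Hu Hv; rewrite -[v]opprK -[- v]sub0r; apply: (HB _ _ Hu); exact: HB.
  rewrite -(subrK v1 p); apply: HD; last by apply: sH; right.
  apply: sH; left; have := group_divr groupG Sp S1.
  by rewrite ptB subrr.
move=> spanp; apply: spanp; split; first exact: periods_subgroup.
move=> q [Lq|->]; first exact: translation_period.
exact: reflection_period.
Qed.

(** Doubling a period of reflection type gives the translation obtained by
    squaring the reflection. *)
Lemma periods_lattice : holohedry (translations G) sigma ->
  is_lattice (periods y0 G).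
Proof.
move=> [_ sL].
have slat : is_lattice (slice 0 (translations G)).
  apply: slice_lattice crysG.2 _ => v Lv; rewrite -sL; by exists v.
have [[v1 S1]|noS] := pselect (exists v1, G (pt v1 y0, sigma)); last first.
  by rewrite periods_no_reflection// => v Sv; apply: noS; exists v.
apply: (lattice_overgroup slat); last exact: periods_subgroup.
  by move=> p; exact: translation_period.
move=> p /(period_dichotomy crysG y0_gt0 y0_notin)[Lp|Sp].
  by have := translationsD groupG Lp Lp; rewrite ptD addr0.
have := group_comp groupG Sp Sp; rewrite sigma_pt ptD subrr -[X in _ *m X]invmx_sigma.
rewrite mulmxV//; exact: orthogonal_unit (group_orthogonal groupG Sp).
Qed.

End PeriodGroup.

Section Shear.
Variables (R : realType) (n : nat).

(** Compare the parities of the 2-adic valuations of 2 k^2 and l^2. *)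
Lemma sqrt2_irrational (k l : int) :
  Num.sqrt 2 * k%:~R + l%:~R = 0 :> R -> k = 0.
Proof.
move=> E; have E2 : (2 * k ^+ 2 = l ^+ 2)%R.
  apply: (@intr_inj R); rewrite intrM !rmorphXn /=.
  have : (l%:~R : R) = - (Num.sqrt 2 * k%:~R) by lra.
  by move=> ->; rewrite sqrrN exprMn sqr_sqrtr.
apply/eqP/negPn/negP => k0.
have := congr1 absz E2; rewrite abszM !abszX => /(congr1 (logn 2)).
rewrite lognM ?expn_gt0 ?absz_gt0 ?k0// !lognX => /(congr1 odd).
by rewrite oddD !oddM.
Qed.

Variable j0 : 'I_n.

(** It tilts the axis j0 upwards with the irrational slope sqrt 2: the image of an
    integer point with a nonzero coordinate along that axis has irrational
    height. *)
Definition shear : 'M[R]_(n + 1) :=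
  block_mx 1%:M 0 (Num.sqrt 2 *: delta_mx 0 j0) 1%:M.

Definition sheared_lattice : set 'cV[R]_(n + 1) :=
  [set v | exists k : 'cV[int]_(n + 1), v = shear *m map_mx intr k].

Lemma shear_inj (u : 'cV[R]_(n + 1)) : shear *m u = 0 -> u = 0.
Proof.
rewrite -(vsubmxK u) mul_block_col !mul1mx mul0mx addr0 -(@col_mx0 _ n 1 1).
by move=> /eq_col_mx[->]; rewrite mulmx0 add0r => ->.
Qed.

Lemma sheared_latticeE (x : 'cV[R]_n) (y : R) : sheared_lattice (pt x y) ->
  exists (k l : int), x j0 0 = k%:~R /\ y = Num.sqrt 2 * k%:~R + l%:~R.
Proof.
move=> [k]; rewrite -[map_mx intr k]vsubmxK mul_block_col !mul1mx mul0mx addr0.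
move=> /eq_col_mx[-> E].
exists (k (lshift 1 j0) 0), (k (rshift n 0) 0); split; first by rewrite !mxE.
have /matrixP/(_ 0 0) := E; rewrite !mxE eqxx mulr1n => ->; congr (_ + _).
rewrite (bigD1 j0)//= !mxE !eqxx mulr1 big1 ?addr0// => i /negPf ij.
by rewrite !mxE eqxx ij mulr0 mul0r.
Qed.

Lemma sheared_is_lattice : is_lattice sheared_lattice.
Proof.
pose b := [tuple shear *m (delta_mx i 0 : 'cV[R]_(n + 1)) | i < n + 1].
have bE (c : 'I_(n + 1) -> R) :
    \sum_i c i *: b`_i = shear *m (\col_i c i).
  rewrite [X in shear *m X]matrix_sum_delta mulmx_sumr; apply: eq_bigr => i _.
  by rewrite big_ord1 mxE -scalemxAr -tnth_nth tnth_mktuple.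
exists b; split.
  apply/freeP => c; rewrite bE => /shear_inj/matrixP c0 i.
  by have := c0 i 0; rewrite !mxE.
have bZ (k : 'I_(n + 1) -> int) :
    \sum_(i < n + 1) b`_i *~ k i = shear *m map_mx intr (\col_i k i).
  under eq_bigr do rewrite -scaler_int.
  rewrite bE; congr (_ *m _); by apply/matrixP => i j; rewrite !mxE.
apply/seteqP; split=> [_ [k ->]|_ [k ->]].
  exists (fun i => k i 0); rewrite bZ; congr (_ *m map_mx _ _).
  by apply/matrixP => i j; rewrite mxE ord1.
by exists (\col_i k i).
Qed.

Definition shear_group : set ('cV[R]_(n + 1) * 'M[R]_(n + 1)) :=
  [set g | sheared_lattice g.1 /\ g.2 = 1%:M].

Lemma translations_shear : translations shear_group = sheared_lattice.
Proof. by apply/seteqP; split=> [v []//|v Lv]; split. Qed.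

Lemma shear_group_crystallographic : crystallographic shear_group.
Proof.
split; last by rewrite translations_shear; exact: sheared_is_lattice.
have LB u v : sheared_lattice u -> sheared_lattice v -> sheared_lattice (u - v).
  by move=> [k ->] [l ->]; exists (k - l); rewrite map_mxB mulmxBr.
have L0 : sheared_lattice 0 by exists 0; rewrite map_mx0 mulmx0.
have LN u : sheared_lattice u -> sheared_lattice (- u).
  by move=> Lu; rewrite -sub0r; exact: LB.
split.
- by move=> g [_ g2]; rewrite /euclidean /= g2 /orthogonal_mx trmx1 mul1mx.
- by split.
- move=> [u d] [v e] [/= Lu ->] [/= Lv ->]; split; rewrite /= mul1mx//.
  by rewrite -[v]opprK; apply: LB => //; exact: LN.
- move=> [u d] [/= Lu ->]; split; rewrite /= invmx1// mul1mx; exact: LN.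
Qed.

End Shear.

(** * The example without enough periods *)

Section Example.
Variables (R : realType) (n : nat) (j0 : 'I_n).

Lemma shear_half_notin : ~ sheared_lattice j0 (pt 0 (1 / 2) : 'cV[R]_(n + 1)).
Proof.
move=> /sheared_latticeE[k [l [+ E]]]; rewrite mxE => /esym/eqP.
rewrite intr_eq0 => /eqP k0; move: E; rewrite k0 mulr0 add0r => l2.
have : (l * 2)%:~R = 1%:~R :> R by rewrite intrM -l2; lra.
by move=> /intr_inj /(congr1 absz) /(congr1 odd); rewrite abszM oddM andbF.
Qed.

(** The reflected image of a tilted basis vector would put 2 sqrt 2 among the
    integers. *)
Lemma shear_not_symmetric : ~ holohedry (sheared_lattice j0) (@sigma R n).
Proof.
move=> [_ sL].
have : sheared_lattice j0 (sigma *m pt (delta_mx j0 0) (Num.sqrt 2) : 'cV[R]_(n + 1)).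
  rewrite -sL; exists (pt (delta_mx j0 0) (Num.sqrt 2)) => //.
  exists (delta_mx (lshift 1 j0) 0); rewrite -[map_mx _ _]vsubmxK.
  rewrite mul_block_col !mul1mx mul0mx addr0; congr col_mx.
    by apply/matrixP => i j; rewrite !mxE (inj_eq (@lshift_inj _ _)); case: (_ && _).
  apply/matrixP => i j; rewrite !ord1 !mxE eqxx mulr1n eq_rlshift/= addr0.
  rewrite (bigD1 j0)//= !mxE !eqxx !mulr1 big1 ?addr0// => t /negPf tj.
  by rewrite !mxE eqxx tj mulr0 mul0r.
rewrite sigma_pt => /sheared_latticeE[k [l [+ E]]]; rewrite mxE !eqxx => k1.
have kE : k = 1 by apply: (@intr_inj R); rewrite -k1.
have : Num.sqrt 2 * (2 : int)%:~R + l%:~R = 0 :> R by move: E; rewrite kE; lra.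
by move=> /sqrt2_irrational.
Qed.

Lemma shear_slice (x : 'cV[R]_n) : slice 0 (sheared_lattice j0) x -> x j0 0 = 0.
Proof.
move=> /sheared_latticeE[k [l [-> /esym/sqrt2_irrational ->]]].
by rewrite mulr0z.
Qed.

Lemma free_in_hyperplane (s : seq 'cV[R]_n) : free s ->
  (forall v, v \in s -> v j0 0 = 0) -> (size s < n)%N.
Proof.
move=> fs s0; rewrite ltnNge; apply/negP => ns.
have sb : basis_of fullv s.
  by rewrite basisEfree fs subvf dimvf dim_matrix mulr1.
have dj : delta_mx j0 0 \in << s >>%VS by rewrite (span_basis sb) memvf.
have := coord_span (dj : _ \in << in_tuple s >>%VS) => /matrixP/(_ j0 0).
rewrite mxE !eqxx summxE big1 => [/eqP|i _]; first by rewrite oner_eq0.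
by rewrite mxE s0 ?mulr0// mem_nth.
Qed.

End Example.

Theorem lemma5p2 (R : realType) (n : nat) (n_ge1 : (1 <= n)%N) :
  (forall (G : set ('cV[R]_(n + 1) * 'M[R]_(n + 1))) (y0 : R),
     crystallographic G -> 0 < y0 -> ~ translations G (pt 0 y0) ->
     [/\ forall v1 : 'cV[R]_n, G (pt v1 y0, sigma) ->
           periods y0 G = Zspan (slice 0 (translations G) `|` [set v1]) /\
           is_lattice (periods y0 G),
         (forall v1 : 'cV[R]_n, ~ G (pt v1 y0, sigma)) ->
           periods y0 G = slice 0 (translations G) &
         holohedry (translations G) sigma -> is_lattice (periods y0 G)]) /\
  (exists (G : set ('cV[R]_(n + 1) * 'M[R]_(n + 1))) (y0 : R),
     [/\ crystallographic G, 0 < y0, ~ translations G (pt 0 y0),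
         ~ holohedry (translations G) sigma &
         forall s : seq 'cV[R]_n, free s ->
           (forall v, v \in s -> periods y0 G v) -> (size s < n)%N]).
Proof.
split=> [G y0 crysG y0_gt0 y0_notin|].
  split=> [v1 S1|noS|sL].
  - split; first exact: periods_reflection.
    apply: periods_lattice => //; apply: (point_group_holohedry crysG.1).
    by exists (pt v1 y0).
  - exact: periods_no_reflection.
  - exact: periods_lattice.
pose j0 := Ordinal n_ge1.
have y0_gt0 : 0 < 1 / 2 :> R by lra.
have y0_notin : ~ translations (@shear_group R n j0) (pt 0 (1 / 2)).
  by rewrite translations_shear; exact: shear_half_notin.
have crysG := @shear_group_crystallographic R n j0.
exists (@shear_group R n j0), (1 / 2); split=> //.
  by rewrite translations_shear; exact: shear_not_symmetric.
move=> s fs sP; apply: (free_in_hyperplane (j0 := j0) fs) => v /sP.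
rewrite (periods_no_reflection crysG y0_gt0 y0_notin).
  by rewrite translations_shear; exact: shear_slice.
by move=> w [_ /= /esym/eqP]; apply/negP; exact: one_neq_sigma.
Qed.
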